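(* Let $X$ be a real Banach space with dual $X^*$. Let $f\colon X\to\,]-\infty,+\infty]$ be a proper lower semicontinuous convex function, and let $B\colon X\rightrightarrows X^*$ be maximally monotone with $\operatorname{dom}\partial f\cap\operatorname{int}\operatorname{dom}B\neq\varnothing$. Then $\partial f+B$ is maximally monotone.
   Context: $X$ is a real Banach space, $X^*$ its continuous dual, $\langle\cdot,\cdot\rangle$ the duality pairing. For a set-valued operator $A\colon X\rightrightarrows X^*$ (i.e. $Ax\subseteq X^*$ for every $x\in X$), $\operatorname{gra}A=\{(x,x^* )\in X\times X^* : x^*\in Ax\}$ and $\operatorname{dom}A=\{x\in X: Ax\neq\varnothing\}$. $A$ is monotone if $\langle x-y,x^*-y^*\rangle\ge 0$ for all $(x,x^* ),(y,y^* )\in\operatorname{gra}A$; it is maximally monotone if it is monotone and has no proper monotone extension (in the sense of graph inclusion). The sum is $(A+B)x=\{a^*+b^* : a^*\in Ax,\ b^*\in Bx\}$. $\operatorname{int}$ denotes norm interior. For $f\colon X\to\,]-\infty,+\infty]$, $f$ is proper if $f^{-1}(\mathbb{R})\neq\varnothing$, and the subdifferential operator of a proper $f$ is $\partial f\colon X\rightrightarrows X^*$, $\partial f(x)=\{x^*\in X^* : \langle y-x,x^*\rangle+f(x)\le f(y)\ \text{for all } y\in X\}$. *)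

(* Defs.v *)
From HB Require Import structures.
From mathcomp Require Import all_boot all_order all_algebra.
From mathcomp Require Import all_classical all_reals.
From mathcomp Require Import ereal topology normedtype.

Set Implicit Arguments.
Unset Strict Implicit.
Unset Printing Implicit Defensive.

Import Order.TTheory GRing.Theory Num.Theory.
Import numFieldNormedType.Exports.

Local Open Scope classical_set_scope.
Local Open Scope ring_scope.

Section Dual.
Context {R : realType} (X : normedModType R).

Definition continuous_linear : {pred X -> R^o} :=
  fun phi => `[< linear phi /\ continuous phi >].

Lemma continuous_linear_submod_closed : submod_closed continuous_linear.
Proof.
split=> [|a u v].
  by apply/asboolP; split=> [b x y|x]; [rewrite /= scaler0 addr0|exact: cvg_cst].
move=> /asboolP[lu cu] /asboolP[lv cv]; apply/asboolP; split=> [b x y|x].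
  have E z : (a *: u + v) z = a *: u z + v z by [].
  by rewrite !E lu lv !scalerDr !scalerA [a * b]mulrC addrACA.
by apply: cvgD; [apply: cvgZr; exact: cu|exact: cv].
Qed.

HB.instance Definition _ :=
  GRing.isSubmodClosed.Build R (X -> R^o) continuous_linear
    continuous_linear_submod_closed.

(* The operations of X^* are inherited from X -> R, hence pointwise.          *)
Record dual := Dual {
  dual_fun :> X -> R^o ;
  _ : dual_fun \in continuous_linear }.

HB.instance Definition _ := [isSub for dual_fun].
HB.instance Definition _ := [Choice of dual by <:].
HB.instance Definition _ := [SubChoice_isSubLmodule of dual by <:].

Lemma dual_linear (phi : dual) : linear phi.
Proof. by have /asboolP[] := valP phi. Qed.

Lemma dual_continuous (phi : dual) : continuous phi.
Proof. by have /asboolP[] := valP phi. Qed.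

Lemma dualDE (phi psi : dual) (x : X) : (phi + psi) x = phi x + psi x.
Proof. by []. Qed.

Lemma dual_ext (phi psi : dual) : phi =1 psi -> phi = psi.
Proof. by move=> e; apply/val_inj/funext. Qed.

End Dual.

Section Operators.
Context {R : realType} {X : normedModType R}.
Implicit Types A B : X -> set (dual X).

Definition pairing (x : X) (xs : dual X) : R := xs x.

Definition gra A : set (X * dual X) := [set p | A p.1 p.2].

Definition dom A : set X := [set x | A x !=set0].

Definition monotone_op A : Prop :=
  forall p q, gra A p -> gra A q -> 0 <= pairing (p.1 - q.1) (p.2 - q.2).

Definition maximally_monotone A : Prop :=
  monotone_op A /\ ~ exists B, monotone_op B /\ gra A `<` gra B.

Definition op_sum A B : X -> set (dual X) :=
  fun x => [set a + b | a in A x & b in B x].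

End Operators.

Section Functions.
Context {R : realType} {X : normedModType R}.
Implicit Types f : X -> \bar R.
Local Open Scope ereal_scope.

Definition proper_fun f : Prop := exists x, f x \is a fin_num.

(* At t = 0 and t = 1 the convention 0 * +oo = 0 makes this trivially true.   *)
Definition convex_efun f : Prop :=
  forall (x y : X) (t : R), (0 <= t <= 1)%R ->
    f (t *: x + (1 - t) *: y)%R <= t%:E * f x + (1 - t)%:E * f y.

Definition subdifferential f : X -> set (dual X) :=
  fun x => [set xs | forall y : X, (pairing (y - x) xs)%:E + f x <= f y].

End Functions.

(* Main.v *)
Require Import Defs.
From mathcomp Require Import all_boot all_order all_algebra.
From mathcomp Require Import all_classical all_reals.
From mathcomp Require Import ereal topology normedtype sequences derive.
From mathcomp Require Import ring lra.

Set Implicit Arguments.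
Unset Strict Implicit.
Unset Printing Implicit Defensive.

Import Order.TTheory GRing.Theory Num.Theory.
Import numFieldNormedType.Exports.

Local Open Scope classical_set_scope.
Local Open Scope ring_scope.

(** Translating, it suffices to consider a pair (0, 0) that is monotonically
    related to the sum: [0 <= <x, xs + ys>] for [xs] in the subdifferential of
    [f] at [x] and [ys] in [B x]. One has to find [c] in [B 0] with [- c] a
    subgradient of [f] at 0.

    Being in [B 0] means lying below the function [q] on the convex hull of
    [dom B] whose epigraph is generated by the pairs [(y, <y, ys>)] of the graph
    ([mem_of_hull_gap]). As [q] is bounded above near an interior point of
    [dom B], the sandwich theorem produces [c] once [f 0 - f y <= q y] for all
    [y] ([least_value_le], [mem_sum0]).

    This inequality comes from an integrated form of the hypothesis along rays,
    [f (t y) <= f y + (1 - t) <y, w>] for [w] in [B (r y)], [r > 1]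
    ([radial_estimate]), itself a consequence of an approximate mean value
    theorem for [f] ([approx_mean_value]), which rests on Ekeland's variational
    principle. With [w] in [B (t y)] it gives [f 0 - f y <= <y, w>] by convexity.
    If [y] and [v] are the same convex combinations of [y_i] and [v_i], where
    [v_i] is in [B y_i], monotonicity between [y_i] and [t y] bounds the
    combination of the [<y_i, v_i>] below by [(1 - t) <y, w> + t <y, v>]; now let
    [t] tend to 0.

    The rays must stay inside the interior of [dom B], so 0 has to be in the
    closure [C] of [dom B]; this is the delicate point ([zero_closed_dom]). If it
    were not, the mean value theorem applied to [f] plus the indicator of [C]
    would give points [x] near the segment from 0 to an interior point and
    subgradients [xs + ns], [ns] normal to [C] at [x], with [<x, xs + ns>] as
    negative as desired. The radial estimate forces such an [x] to be in [dom B]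
    ([subgrad_in_dom]); then [B x + ns] is contained in [B x], and the hypothesis
    is violated because [<x, ys>] is bounded above for [ys] in [B x]. *)

(** * Linear identities between vectors *)

Section VectorIdentities.
Context {R : comNzRingType} {V : lmodType R}.

Inductive vexp :=
  | VZero | VAtom of nat | VAdd of vexp & vexp | VOpp of vexp
  | VScale of R & vexp.

Fixpoint veval (env : seq V) (e : vexp) : V :=
  match e with
  | VZero => 0
  | VAtom i => env`_i
  | VAdd e1 e2 => veval env e1 + veval env e2
  | VOpp e1 => - veval env e1
  | VScale a e1 => a *: veval env e1
  end.

Fixpoint vcoef (e : vexp) (i : nat) : R :=
  match e with
  | VZero => 0
  | VAtom j => if i == j then 1 else 0
  | VAdd e1 e2 => vcoef e1 i + vcoef e2 i
  | VOpp e1 => - vcoef e1 i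
  | VScale a e1 => a * vcoef e1 i
  end.

Fixpoint all_below (n : nat) (P : nat -> Prop) : Prop :=
  if n is m.+1 then P m /\ all_below m P else True.

Lemma all_belowP n P : all_below n P -> forall i, (i < n)%N -> P i.
Proof.
elim: n => // n IH [Pn /IH Pl] i; rewrite ltnS leq_eqVlt => /orP[/eqP->//|].
exact: Pl.
Qed.

Lemma veval_coef env e :
  veval env e = \sum_(i < size env) vcoef e i *: env`_i.
Proof.
elim: e => [|j|e1 IH1 e2 IH2|e1 IH|a e1 IH] /=.
- by rewrite big1// => i _; rewrite scale0r.
- have [jn|nj] := ltnP j (size env); last first.
    rewrite nth_default// big1// => i _; rewrite ltn_eqF ?scale0r//.
    exact: leq_trans (ltn_ord i) nj.
  rewrite (bigD1 (Ordinal jn))//= eqxx scale1r big1 ?addr0// => i nij.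
  by rewrite (_ : (i == j :> nat) = false) ?scale0r//; apply/negbTE.
- by rewrite IH1 IH2 -big_split/=; apply: eq_bigr => i _; rewrite scalerDl.
- by rewrite IH -sumrN; apply: eq_bigr => i _; rewrite scaleNr.
- by rewrite IH scaler_sumr; apply: eq_bigr => i _; rewrite scalerA.
Qed.

(** A linear identity holds as soon as the coefficients of each atom agree:
    this turns vector bookkeeping into scalar identities. *)
Lemma veval_eq env e1 e2 :
  all_below (size env) (fun i => vcoef e1 i = vcoef e2 i) ->
  veval env e1 = veval env e2.
Proof.
move=> /all_belowP h; rewrite !veval_coef; apply: eq_bigr => i _.
by rewrite h.
Qed.

End VectorIdentities.

Ltac vatom x env :=
  lazymatch env with
  | x :: _ => constr:(0%N)
  | _ :: ?env' => let i := vatom x env' in constr:(i.+1)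
  end.

Ltac vcollect t env :=
  lazymatch t with
  | 0%R => env
  | (?a + ?b)%R => let env := vcollect a env in vcollect b env
  | (- ?a)%R => vcollect a env
  | (_ *: ?a)%R => vcollect a env
  | _ => lazymatch env with
         | context [t :: _] => env
         | _ => constr:(t :: env)
         end
  end.

Ltac vreify R t env :=
  lazymatch t with
  | 0%R => constr:(@VZero R)
  | (?a + ?b)%R => let a := vreify R a env in let b := vreify R b env in
                   constr:(VAdd a b)
  | (- ?a)%R => let a := vreify R a env in constr:(VOpp a)
  | (?c *: ?a)%R => let a := vreify R a env in constr:(@VScale R c a)
  | _ => let i := vatom t env in constr:(@VAtom R i)
  end.

(* Reduces an equation between linear combinations of vectors with scalars in *)
(* [R] to the equations between their coefficients.                           *)
Ltac vlin R :=
  lazymatch goal with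
  | |- @eq ?V ?l ?r =>
    let env := vcollect l (@nil V) in
    let env := vcollect r env in
    let l' := vreify R l env in
    let r' := vreify R r env in
    apply: (@veval_eq R _ env l' r') => /=; repeat split
  end.

(** * Continuous functionals *)

Section Pairing.
Context {R : realType} {X : normedModType R}.
Implicit Types (x y h : X) (xs ys : dual X).

Lemma pairingDl x y xs : pairing (x + y) xs = pairing x xs + pairing y xs.
Proof. by have := dual_linear xs 1 x y; rewrite !scale1r. Qed.

Lemma pairing0l xs : pairing 0 xs = 0.
Proof.
apply: (@addrI _ (pairing 0 xs)).
by rewrite -pairingDl !addr0.
Qed.

Lemma pairingZl t x xs : pairing (t *: x) xs = t * pairing x xs.
Proof.
have := dual_linear xs t x 0; rewrite !addr0.
by rewrite -/(pairing 0 xs) pairing0l addr0.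
Qed.

Lemma pairingNl x xs : pairing (- x) xs = - pairing x xs.
Proof. by rewrite -scaleN1r pairingZl mulN1r. Qed.

Lemma pairingDr x xs ys : pairing x (xs + ys) = pairing x xs + pairing x ys.
Proof. by []. Qed.

Lemma pairingNr x xs : pairing x (- xs) = - pairing x xs.
Proof. by []. Qed.

Lemma pairing0r x : pairing x 0 = 0.
Proof. by []. Qed.

Lemma pairingZr t x xs : pairing x (t *: xs) = t * pairing x xs.
Proof. by []. Qed.

Definition pairingE := (pairingDl, pairingDr, pairingZl, pairingZr, pairingNl,
  pairingNr, pairing0l, pairing0r).

(** [N] is at least the operator norm of [xs]; no absolute value is needed, by
    symmetry in [h]. *)
Definition dual_bound xs (N : R) := forall h, pairing h xs <= N * `|h|.

Lemma dual_bound_ge xs N h : dual_bound xs N -> - (N * `|h|) <= pairing h xs.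
Proof. by move=> /(_ (- h)); rewrite normrN pairingNl lerNl. Qed.

Lemma dual_boundW xs N M : N <= M -> dual_bound xs N -> dual_bound xs M.
Proof. by move=> NM b h; apply: le_trans (b h) _; rewrite ler_wpM2r. Qed.

(** Homogeneity: the values on one sphere control the norm. *)
Lemma dual_bound_ball xs d N : 0 < d ->
  (forall h, `|h| <= d -> pairing h xs <= N * d) -> dual_bound xs N.
Proof.
move=> d0 b h; have [->|h0] := eqVneq h 0.
  by rewrite pairing0l normr0 mulr0.
have n0 : 0 < `|h| by rewrite normr_gt0.
have := b ((d / `|h|) *: h); rewrite normrZ gtr0_norm ?divr_gt0//.
rewrite divfK ?gt_eqF// lexx => /(_ isT); rewrite pairingZl => {}b.
have -> : pairing h xs = `|h| / d * (d / `|h| * pairing h xs).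
  by field; rewrite !gt_eqF.
apply: le_trans (ler_wpM2l _ b) _; first by rewrite ltW// divr_gt0.
by rewrite le_eqVlt; apply/orP; left; apply/eqP; field; rewrite gt_eqF.
Qed.

Lemma dual_bounded xs : exists2 N, 0 < N & dual_bound xs N.
Proof.
have /cvgrPdist_le/(_ 1 ltr01) : xs x @[x --> 0] --> xs 0.
  exact: dual_continuous.
move=> /nbhs_ballP[d /= d0 hd].
exists (2 / d); first by rewrite divr_gt0.
apply: (@dual_bound_ball _ (d / 2)); first by rewrite divr_gt0.
move=> h hle; have /hd : ball (0 : X) d h.
  rewrite -ball_normE /ball_/= sub0r normrN.
  by apply: le_lt_trans hle _; lra.
rewrite /= -/(pairing 0 xs) pairing0l sub0r normrN -/(pairing h xs).
move=> le1; apply: le_trans (ler_norm _) _; apply: le_trans le1 _.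
by rewrite le_eqVlt; apply/orP; left; apply/eqP; field; rewrite gt_eqF.
Qed.

Lemma dual_of_bounded (l : X -> R) (N : R) :
  (forall x y, l (x + y) = l x + l y) ->
  (forall t x, l (t *: x) = t * l x) ->
  (forall h, l h <= N * `|h|) ->
  exists xs : dual X, forall h, pairing h xs = l h.
Proof.
move=> lD lZ lN; have ll : linear (l : X -> R^o).
  by move=> t x y; rewrite lD lZ.
have lB x y : l (x - y) = l x - l y by rewrite lD -scaleN1r lZ mulN1r.
have lc : continuous (l : X -> R^o).
  move=> x; apply/cvgrPdist_le => e e0.
  pose M := `|N| + 1.
  have M0 : 0 < M by rewrite ltr_wpDl.
  have lM h : l h <= M * `|h|.
    apply: le_trans (lN h) _; rewrite ler_wpM2r//.
    by apply: le_trans (ler_norm _) _; rewrite lerDl.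
  have eM : 0 < e / M by rewrite divr_gt0.
  apply/nbhs_ballP; exists (e / M) => //= y; rewrite -ball_normE /ball_/= => xy.
  have xyM : M * `|x - y| <= e by rewrite mulrC -ler_pdivlMr// ltW.
  rewrite ler_norml -!lB; have h1 := lM (x - y); have h2 := lM (y - x).
  rewrite distrC in h2; rewrite !lB in h1 h2 *.
  by apply/andP; split; lra.
have cl : (l : X -> R^o) \in @continuous_linear R X by apply/asboolP.
by exists (Dual cl).
Qed.

End Pairing.

(** * Sublinear functionals and separation *)

Section HahnBanach.
Context {R : realType} {X : normedModType R}.

Definition sublinear (q : X -> R) :=
  (forall x y, q (x + y) <= q x + q y) /\
  (forall t x, 0 < t -> q (t *: x) <= t * q x).

Lemma sublinearZ q t x : sublinear q -> 0 < t -> q (t *: x) = t * q x.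
Proof.
move=> [_ qZ] t0; apply/eqP; rewrite eq_le qZ//=.
have := qZ t^-1 (t *: x); rewrite invr_gt0 scalerA mulVf ?gt_eqF// scale1r.
by move=> /(_ t0); rewrite ler_pdivlMl.
Qed.

Lemma sublinear0 q : sublinear q -> q 0 = 0.
Proof.
move=> sq; have := sublinearZ 0 sq (ltr0Sn _ 1); rewrite scaler0; lra.
Qed.

Lemma sublinear_ge q x : sublinear q -> - q (- x) <= q x.
Proof.
move=> sq; have := sq.1 x (- x); rewrite subrr sublinear0//; lra.
Qed.

(** Zorn's lemma below a sublinear functional; a chain is bounded below by its
    pointwise infimum. *)
Lemma minimal_sublinear p : sublinear p -> exists q, [/\ sublinear q,
  forall x, q x <= p x & forall r, sublinear r -> (forall x, r x <= q x) -> r = q].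
Proof.
move=> sp; pose T := {q : X -> R | sublinear q /\ forall x, q x <= p x}.
pose le (u v : T) : bool := `[< forall x, sval v x <= sval u x >].
have [|||A totA|t tmin] := @Zorn T le.
- by move=> t; apply/asboolP.
- move=> r s t /asboolP rs /asboolP st; apply/asboolP => x.
  exact: le_trans (st x) (rs x).
- move=> [s sP] [t tP] /asboolP /= st /asboolP /= ts.
  have E : s = t by apply/funext => x; apply/eqP; rewrite eq_le st ts.
  by rewrite -E in tP *; congr exist; exact: Prop_irrelevance.
- have [[t0 At0]|A0] := pselect (exists t, A t); last first.
    exists (exist _ p (conj sp (fun x => lexx (p x)))) => s As.
    by exfalso; apply: A0; exists s.
  pose V x := [set sval t x | t in A].
  have Vn x : V x !=set0 by exists (sval t0 x), t0.
  have Vl x : lbound (V x) (- p (- x)).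
    move=> _ [t At <-]; have [st tp] := svalP t.
    by apply: le_trans (sublinear_ge x st); rewrite lerN2.
  have Vb x : has_lbound (V x) by exists (- p (- x)).
  pose q x := inf (V x).
  have qle t x : A t -> q x <= sval t x.
    by move=> At; apply: ge_inf => //; exists t.
  have qge x c : (forall t, A t -> c <= sval t x) -> c <= q x.
    by move=> h; apply: lb_le_inf => // _ [t At <-]; exact: h.
  have sq : sublinear q.
    split=> [x y|t x t0'].
      rewrite -lerBlDr; apply: (qge) => s As; rewrite lerBlDr -lerBlDl.
      apply: (qge) => t At; rewrite lerBlDl.
      have [/asboolP st|/asboolP ts] := totA _ _ As At.
        apply: le_trans (qle _ (x + y) At) _; apply: le_trans ((svalP t).1.1 _ _) _.
        by rewrite lerD2r.
      apply: le_trans (qle _ (x + y) As) _; apply: le_trans ((svalP s).1.1 _ _) _.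
      by rewrite lerD2l.
    rewrite mulrC -ler_pdivrMr//; apply: (qge) => s As.
    rewrite ler_pdivrMr// mulrC -(sublinearZ _ (svalP s).1)//.
    exact: qle.
  have qp x : q x <= p x by apply: le_trans (qle _ x At0) ((svalP t0).2 x).
  exists (exist _ q (conj sq qp)) => s As; apply/asboolP => x /=.
  exact: qle.
- have [st tp] := svalP t; exists (sval t); split=> // r sr rt.
  have rp x : r x <= p x by apply: le_trans (rt x) (tp x).
  by rewrite -(tmin (exist _ r (conj sr rp)))//; apply/asboolP.
Qed.

(** Minimality against the sublinear functional
    [x |-> inf_(t >= 0) (q (x + t u) - t q u)] forces
    [q x + q u <= q (x + u)], so a minimal sublinear functional is additive. *)
Lemma hahn_banach p : sublinear p -> exists l : X -> R,
  [/\ forall x y, l (x + y) = l x + l y, forall t x, l (t *: x) = t * l x &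
      forall x, l x <= p x].
Proof.
move=> /minimal_sublinear[q [sq qp qmin]].
have qD x u : q (x + u) = q x + q u.
  pose V x := [set q (x + t *: u) - t * q u | t in [set t | 0 <= t]].
  have Vn y : V y !=set0 by exists (q (y + 0 *: u) - 0 * q u), 0 => /=.
  have Vl y : lbound (V y) (- q (- y)).
    move=> _ [t /= t0 <-].
    have := sq.1 (y + t *: u) (- y).
    have -> : y + t *: u - y = t *: u by vlin R; ring.
    have [t0e|t0e] := eqVneq t 0; last have t0p : 0 < t by rewrite lt_neqAle eq_sym t0e t0.
      rewrite t0e scale0r mul0r addr0 sublinear0//; lra.
    rewrite (sublinearZ _ sq t0p); lra.
  have Vb y : has_lbound (V y) by exists (- q (- y)).
  pose r y := inf (V y).
  have rle t y : 0 <= t -> r y <= q (y + t *: u) - t * q u.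
    by move=> t0; apply: ge_inf => //; exists t.
  have rge y c : (forall t, 0 <= t -> c <= q (y + t *: u) - t * q u) -> c <= r y.
    by move=> h; apply: lb_le_inf => // _ [t t0 <-]; exact: h.
  have rq y : r y <= q y.
    by apply: le_trans (rle 0 y _) _; rewrite ?scale0r ?addr0 ?mul0r ?subr0.
  have sr : sublinear r.
    split=> [y z|t y t0].
      rewrite -lerBlDr; apply: (rge) => s s0; rewrite lerBlDr -lerBlDl.
      apply: (rge) => t t0; rewrite lerBlDl.
      apply: le_trans (rle (s + t) _ _) _; first exact: addr_ge0.
      have -> : y + z + (s + t) *: u = (y + s *: u) + (z + t *: u).
        by vlin R; ring.
      have := sq.1 (y + s *: u) (z + t *: u); lra.
    rewrite mulrC -ler_pdivrMr//; apply: (rge) => s s0.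
    rewrite ler_pdivrMr//; apply: le_trans (rle (s * t) _ _) _.
      by rewrite mulr_ge0// ltW.
    have -> : t *: y + (s * t) *: u = t *: (y + s *: u) by vlin R; ring.
    rewrite sublinearZ//; lra.
  have := rle 1 x ler01; rewrite (qmin _ sr rq) scale1r mul1r.
  by have := sq.1 x u; move=> ? ?; apply/eqP; rewrite eq_le; apply/andP; split; lra.
have qN x : q (- x) = - q x.
  by have := qD x (- x); rewrite subrr sublinear0//; lra.
exists q; split=> // t x; have [t0|t0|->] := ltrgt0P t.
- exact: sublinearZ.
- have := sublinearZ x sq (_ : 0 < - t); rewrite oppr_gt0 scaleNr qN => /(_ t0).
  lra.
- by rewrite scale0r sublinear0// mul0r.
Qed.

End HahnBanach.

Section Sandwich.
Context {R : realType} {X : normedModType R}.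
Implicit Types (F G : X -> R -> Prop).

(** Extended-valued convex functions enter only through sets of pairs (point,
    upper bound of the value), that is, through their epigraphs; this keeps all
    the arithmetic in the real numbers. *)
Definition convex_rel F := forall x a y b t, 0 <= t <= 1 -> F x a -> F y b ->
  F (t *: x + (1 - t) *: y) (t * a + (1 - t) * b).

Lemma convex_rel_add F x a y b s t : convex_rel F -> 0 < s -> 0 < t ->
  F x a -> F y b ->
  F ((s + t)^-1 *: (s *: x + t *: y)) ((s + t)^-1 * (s * a + t * b)).
Proof.
move=> cF s0 t0 Fx Fy; have st0 : 0 < s + t by rewrite addr_gt0.
have st1 : 0 <= s / (s + t) <= 1.
  by rewrite ler_pdivrMr// mul1r lerDl (ltW t0) divr_ge0// ltW.
have := cF x a y b (s / (s + t)) st1 Fx Fy.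
have -> : s / (s + t) *: x + (1 - s / (s + t)) *: y =
    (s + t)^-1 *: (s *: x + t *: y) by vlin R; field; rewrite gt_eqF.
by congr (F _ _); field; rewrite gt_eqF.
Qed.

(** The Hahn-Banach theorem for the functional
    [u |-> inf (s (a + b))] over [u = s (y - x)], [0 < s], [F x a], [G y b], the
    largest positively homogeneous minorant of the perturbation function
    [u |-> inf (a + b)] over [u = y - x]. It is finite because the sum of the two
    functions is nonnegative, and at most a multiple of the norm because [G] is
    bounded above near a point of the domain of [F]. *)
Lemma sandwich F G x0 a0 M d : convex_rel F -> convex_rel G ->
  (forall x a b, F x a -> G x b -> 0 <= a + b) ->
  F x0 a0 -> 0 < d -> (forall h, `|h| < d -> G (x0 + h) M) ->
  exists l : dual X,
    forall x a y b, F x a -> G y b -> pairing (y - x) l <= a + b.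
Proof.
move=> cF cG FG0 F0 d0 GM.
pose V u := [set c | exists s x a y b,
  [/\ 0 < s, F x a, G y b, u = s *: (y - x) & c = s * (a + b)]].
have Vball u s : 0 < s -> `|u| < s * d -> V u (s * (a0 + M)).
  move=> s0 us; exists s, x0, a0, (x0 + s^-1 *: u), M; split => //.
    apply: GM; rewrite normrZ gtr0_norm ?invr_gt0// mulrC ltr_pdivrMr//.
    by rewrite mulrC.
  by vlin R; field; rewrite gt_eqF.
have VD u v c e : V u c -> V v e -> V (u + v) (c + e).
  move=> [s [x [a [y [b [s0 Fx Gy -> ->]]]]]].
  move=> [t [x' [a' [y' [b' [t0 Fx' Gy' -> ->]]]]]].
  have st0 : 0 < s + t by rewrite addr_gt0.
  exists (s + t), ((s + t)^-1 *: (s *: x + t *: x')),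
    ((s + t)^-1 * (s * a + t * a')), ((s + t)^-1 *: (s *: y + t *: y')),
    ((s + t)^-1 * (s * b + t * b')); split; rewrite ?addr_gt0//.
  - exact: convex_rel_add.
  - exact: convex_rel_add.
  - by vlin R; field; rewrite gt_eqF.
  - by field; rewrite gt_eqF.
have VZ t u c : 0 < t -> V u c -> V (t *: u) (t * c).
  move=> t0 [s [x [a [y [b [s0 Fx Gy -> ->]]]]]].
  by exists (t * s), x, a, y, b; rewrite mulr_gt0// scalerA mulrA.
have V0 c : V 0 c -> 0 <= c.
  move=> [s [x [a [y [b [s0 Fx Gy /esym/eqP e ->]]]]]].
  move: e; rewrite scaler_eq0 gt_eqF//= subr_eq0 => /eqP xy.
  by rewrite mulr_ge0 ?(ltW s0)// (FG0 x)// -xy.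
have Vn u : V u !=set0.
  exists ((`|u| / d + 1) * (a0 + M)); apply: Vball.
    by rewrite ltr_wpDl// divr_ge0// ltW.
  by rewrite mulrDl divfK ?gt_eqF// mul1r ltrDl.
have Vl u : has_lbound (V u).
  have [c Vc] := Vn (- u); exists (- c) => e Ve.
  by have := VD _ _ _ _ Vc Ve; rewrite addNr => /V0; lra.
pose p u := inf (V u).
have ple u c : V u c -> p u <= c by move=> Vc; exact: ge_inf.
have pge u c : (forall e, V u e -> c <= e) -> c <= p u.
  by move=> h; exact: lb_le_inf.
have sp : sublinear p.
  split=> [u v|t u t0].
    rewrite -lerBlDr; apply: (pge) => c Vc; rewrite lerBlDr -lerBlDl.
    apply: (pge) => e Ve; rewrite lerBlDl.
    exact/ple/VD.
  rewrite mulrC -ler_pdivrMr//; apply: (pge) => c Vc.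
  by rewrite ler_pdivrMr// mulrC; exact/ple/VZ.
have [l [lD lZ lp]] := hahn_banach sp.
have [|L LE] := @dual_of_bounded R X l (2 * (a0 + M) / d) lD lZ.
  move=> h; have [->|h0] := eqVneq h 0.
    by apply: le_trans (lp _) _; rewrite sublinear0// normr0 mulr0.
  have n0 : 0 < `|h| by rewrite normr_gt0.
  apply: le_trans (lp _) _.
  have -> : 2 * (a0 + M) / d * `|h| = (2 * `|h| / d) * (a0 + M) by ring.
  apply/ple/Vball; first by rewrite !mulr_gt0// invr_gt0.
  rewrite divfK ?gt_eqF//; lra.
exists L => x a y b Fx Gy; rewrite LE; apply: le_trans (lp _) _.
by apply: ple; exists 1, x, a, y, b; rewrite scale1r mul1r.
Qed.

End Sandwich.

(** * Subgradients of convex functions given by their epigraphs *)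

Section Epigraphs.
Context {R : realType} {X : completeNormedModType R}.
Implicit Types (E : X -> R -> Prop) (C : set X).

Definition upward_rel E := forall x a b, E x a -> a <= b -> E x b.

Definition closed_rel E := forall x a,
  (forall e, 0 < e -> exists y, `|y - x| < e /\ E y (a + e)) -> E x a.

(** The second clause at [y = x] makes [a] the least number above [x], that is,
    the value of the function at [x]. *)
Definition subgrad_at E x a (xs : dual X) :=
  E x a /\ forall y b, E y b -> pairing (y - x) xs + a <= b.

Definition subgrad E x xs := exists a, subgrad_at E x a xs.

Definition restrict_rel E C x a := E x a /\ C x.

(** Sum rule for adding the indicator function of [C], under the interior
    condition: a subgradient of the sum splits off a normal vector to [C]. *)
Lemma subgrad_restrict E C x0 a0 d x a xs : convex_rel E ->
  (forall u v t, 0 <= t <= 1 -> C u -> C v -> C (t *: u + (1 - t) *: v)) ->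
  E x0 a0 -> 0 < d -> (forall h, `|h| < d -> C (x0 + h)) ->
  subgrad_at (restrict_rel E C) x a xs ->
  exists2 ns, subgrad E x (xs - ns) & forall y, C y -> pairing (y - x) ns <= 0.
Proof.
move=> cE cC E0 d0 dC [[Ex Cx] xsx].
pose F y b := E y (b + (pairing (y - x) xs + a)).
pose G (y : X) (b : R) := C y /\ 0 <= b.
have [||||||l hl] := @sandwich R X F G x0 (a0 - (pairing (x0 - x) xs + a)) 0 d.
- move=> u b v c t t01 Fu Fv; have := cE _ _ _ _ _ t01 Fu Fv; rewrite /F.
  by congr (E _ _); rewrite !pairingE; ring.
- move=> u b v c t t01 [Cu b0] [Cv c0]; split; first exact: cC.
  by move/andP: t01 => [t0 t1]; rewrite addr_ge0// mulr_ge0// subr_ge0.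
- move=> u b c Fu [Cu c0]; have := xsx _ _ (conj Fu Cu); lra.
- by rewrite /F subrK.
- by [].
- by move=> h hd; split; [exact: dC|].
have Fx : F x 0 by rewrite /F subrr pairing0l !add0r.
exists l; last first.
  by move=> y Cy; have := hl x 0 y 0 Fx (conj Cy (lexx 0)); rewrite addr0.
exists a; split=> // y b Ey.
have Fy : F y (b - (pairing (y - x) xs + a)) by rewrite /F subrK.
have := hl _ _ x 0 Fy (conj Cx (lexx 0)); rewrite !pairingE; lra.
Qed.

End Epigraphs.

Section Ekeland.
Context {R : realType} {X : completeNormedModType R}.
Implicit Types (E : X -> R -> Prop).

(** The variational principle, stated for pairs (point, upper bound of the
    value). Each step moves to a point that dominates the previous one, going at
    least halfway down to the infimum of the values of such points; the decrease
    of the values controls the distances, so the points converge, and no point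
    with a smaller value dominates the limit. *)
Lemma ekeland E x0 a0 m k : upward_rel E -> closed_rel E ->
  (forall x a, E x a -> m <= a) -> E x0 a0 -> 0 < k ->
  exists x a, [/\ E x a, a <= a0 &
    forall y b, E y b -> a <= b + k * `|y - x|].
Proof.
move=> upE clE mE E0 k0.
pose S (p q : X * R) := E q.1 q.2 /\ q.2 + k * `|q.1 - p.1| <= p.2.
have Sle p q : S p q -> q.2 <= p.2.
  by move=> [_]; apply: le_trans; rewrite lerDl mulr_ge0// ltW.
have Srefl p : E p.1 p.2 -> S p p.
  by move=> Ep; split=> //; rewrite subrr normr0 mulr0 addr0.
have Strans p q r : S p q -> S q r -> S p r.
  move=> [_ pq] [Er qr]; split=> //.
  have := ler_distD q.1 r.1 p.1; rewrite -(ler_pM2l k0) mulrDr; lra.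
have step p : exists q, E p.1 p.2 ->
    S p q /\ forall r, S p r -> 2 * q.2 - p.2 <= r.2.
  have [Ep|nEp] := pselect (E p.1 p.2); last by exists p.
  pose V := [set r.2 | r in S p].
  have Vn : V !=set0 by exists p.2, p => //; exact: Srefl.
  have Vl : has_lbound V by exists m => _ [r [Er _] <-]; exact: mE Er.
  have [lt|ge] := ltP (inf V) p.2.
    have [|_ [q pq <-] qlt] := @inf_adherent _ V ((p.2 - inf V) / 2) _ (conj Vn Vl).
      by rewrite divr_gt0// subr_gt0.
    exists q => _; split=> // r pr; apply: le_trans (ge_inf Vl _); last first.
      by exists r.
    lra.
  exists p => _; split=> [|r pr]; first exact: Srefl.
  have : inf V <= r.2 by apply: ge_inf => //; exists r.
  lra.
have [nx nxP] := choice step.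
pose u n := iter n nx (x0, a0).
have uE n : E (u n).1 (u n).2.
  by elim: n => [|n IH]//=; have [[]] := nxP _ IH.
have uS n j : S (u n) (u (j + n)%N).
  elim: j => [|j IH]; first exact: Srefl.
  by apply: Strans IH _; have [] := nxP _ (uE (j + n)%N).
have uge n r : S (u n) r -> 2 * (u n.+1).2 - (u n).2 <= r.2.
  by have [_ h] := nxP _ (uE n); exact: h.
pose V := [set (u n).2 | n in setT].
have Vn : V !=set0 by exists (u 0%N).2, 0%N.
have Vl : has_lbound V by exists m => _ [n _ <-]; exact: mE (uE n).
pose a := inf V.
have au n : a <= (u n).2 by apply: ge_inf => //; exists n.
have ua d : 0 < d -> exists n, (u n).2 < a + d.
  by move=> d0; have [_ [n _ <-]] := inf_adherent d0 (conj Vn Vl); exists n.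
have udist n j : k * `|(u (j + n)%N).1 - (u n).1| <= (u n).2 - a.
  by have [_] := uS n j; have := au (j + n)%N; lra.
have cu : cvg ((fst \o u) @ \oo).
  apply: cauchy_cvg; apply: cauchy_exP => d d0.
  have [n nd] := ua (k * d) (mulr_gt0 k0 d0).
  exists (u n).1; exists n => // i /= ni; rewrite -ball_normE /ball_/= distrC.
  have := udist n (i - n)%N; rewrite subnK// => h.
  by rewrite -(ltr_pM2l k0); apply: le_lt_trans h _; lra.
pose x := lim ((fst \o u) @ \oo).
have xlim d N : 0 < d -> exists2 i, (N <= i)%N & `|(u i).1 - x| < d.
  move=> d0; have /cvgrPdist_lt/(_ d d0)[n _ hn] := cu.
  exists (maxn N n); first exact: leq_maxl.
  by rewrite distrC; apply: hn => /=; exact: leq_maxr.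
have Exa : E x a.
  apply: clE => d d0; have [n nd] := ua d d0; have [i ni id] := xlim d n d0.
  exists (u i).1; split=> //; apply: upE (uE i) _.
  by have := Sle _ _ (uS n (i - n)%N); rewrite subnK//; lra.
have Sx n : S (u n) (x, a).
  split=> //=; apply/ler_addgt0Pr => d d0.
  have dk : 0 < d / k by rewrite divr_gt0.
  have [i ni id] := xlim _ n dk.
  have := udist n (i - n)%N; rewrite subnK// => h.
  have := ler_distD (u i).1 x (u n).1; rewrite -(ler_pM2l k0) mulrDr => h2.
  move: id; rewrite distrC ltr_pdivlMr// mulrC; lra.
exists x, a; split=> //; first exact: (au 0%N).
move=> y b Ey; rewrite leNgt; apply/negP => lt.
have Sy n : S (u n) (y, b).
  by apply: Strans (Sx n) _; split=> //=; exact: ltW.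
have ba : b < a by apply: le_lt_trans lt; rewrite lerDl mulr_ge0// ltW.
have [n nd] := ua (a - b) (eqbRL (subr_gt0 _ _) ba).
by have := uge _ _ (Sy n); have := au n.+1; rewrite /=; lra.
Qed.

End Ekeland.

Section ApproximateMeanValue.
Context {R : realType} {X : completeNormedModType R}.
Implicit Types (E : X -> R -> Prop).

(** Having an exact minimiser for every [x] makes the penalty
    [min_s (K |x - c s| - s m)] convex and [K]-Lipschitz by direct comparison. *)
Lemma segment_penalty (v e : X) (K m : R) : exists sel : X -> R, forall x,
  0 <= sel x <= 1 /\ forall s, 0 <= s <= 1 ->
  K * `|x - (v + sel x *: (e - v))| - sel x * m <=
  K * `|x - (v + s *: (e - v))| - s * m.
Proof.
suff h x : exists t, 0 <= t <= 1 /\ forall s, 0 <= s <= 1 ->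
    K * `|x - (v + t *: (e - v))| - t * m <=
    K * `|x - (v + s *: (e - v))| - s * m.
  by have [sel selP] := choice h; exists sel.
pose g s : R := K * `|x - (v + s *: (e - v))| - s * m.
have cg : continuous g.
  move=> s; apply: cvgB; last by apply: cvgMr_tmp; exact: cvg_id.
  apply: cvgMl_tmp; apply: cvg_norm; apply: cvgB; first exact: cvg_cst.
  by apply: cvgD; [exact: cvg_cst|apply: cvgZr_tmp; exact: cvg_id].
have [s s01 smin] := @EVT_min R g 0 1 ler01 (continuous_subspaceT cg).
exists s; split; first by rewrite in_itv /= in s01.
by move=> t t01; apply: smin; rewrite in_itv /=.
Qed.

(** Approximate mean value theorem. Minimise, up to a small slope, the function
    plus the penalty [min_s (K |x - c s| - s (r - a0))], where [c s] runs through
    the segment from [v] to [e]. For large [K] the minimiser stays close to the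
    segment, and it is not near [e] because the function exceeds [r] there. The
    sandwich theorem yields a subgradient opposed to a subgradient of the
    penalty; moving along the segment and moving towards the segment give the
    two inequalities. *)
Lemma approx_mean_value E v a0 e r n p c : convex_rel E -> upward_rel E ->
  closed_rel E -> (forall x a, E x a -> pairing x p + c <= a) ->
  E v a0 -> ~ E e r -> 0 < n ->
  exists s x xs, [/\ 0 <= s < 1, `|x - (v + s *: (e - v))| <= n, subgrad E x xs,
    0 <= pairing (v + s *: (e - v) - x) xs &
    r - a0 - n <= pairing (e - v) xs].
Proof.
move=> cE upE clE minE Ev nEe n0.
pose m := r - a0; pose w := e - v.
have [z z0 zP] : exists2 z, 0 < z & forall y, `|y - e| < z -> ~ E y r.
  apply: contra_notP nEe => h; apply: clE => d d0.
  apply: contra_notP h => h; exists d => // y yd Ey.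
  by apply: h; exists y; split=> //; apply: upE Ey _; rewrite lerDl ltW.
have [P P0 pP] := dual_bounded p.
pose W := a0 + `|m| - c + P * (`|v| + `|w|).
pose n' := Num.min n (z / 2).
have n'0 : 0 < n' by rewrite /n' lt_min n0 divr_gt0.
pose K := P + (`|W| + 1) / n'.
have KP : P < K by rewrite /K ltrDl divr_gt0// ltr_wpDl.
have K0 : 0 < K by exact: lt_trans KP.
have [sel selP] := segment_penalty v e K m.
pose psi x := K * `|x - (v + sel x *: w)| - sel x * m.
have psile x s : 0 <= s <= 1 -> psi x <= K * `|x - (v + s *: w)| - s * m.
  by move=> s01; have [_] := selP x; exact.
have psiL x y : psi y <= psi x + K * `|y - x|.
  apply: le_trans (psile y _ (selP x).1) _; rewrite /psi.
  have := ler_distD x y (v + sel x *: w); rewrite -(ler_pM2l K0) mulrDr; lra.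
have psiC x y t : 0 <= t <= 1 ->
    psi (t *: x + (1 - t) *: y) <= t * psi x + (1 - t) * psi y.
  move=> /andP[t0 t1]; have u0 : 0 <= 1 - t by rewrite subr_ge0.
  have [/andP[x0 x1] _] := selP x; have [/andP[y0 y1] _] := selP y.
  apply: le_trans (psile _ (t * sel x + (1 - t) * sel y) _) _.
    rewrite addr_ge0 ?mulr_ge0//=.
    have := ler_wpM2l t0 x1; have := ler_wpM2l u0 y1; lra.
  have -> : t *: x + (1 - t) *: y - (v + (t * sel x + (1 - t) * sel y) *: w) =
      t *: (x - (v + sel x *: w)) + (1 - t) *: (y - (v + sel y *: w)).
    by vlin R; ring.
  have := ler_normD (t *: (x - (v + sel x *: w)))
                    ((1 - t) *: (y - (v + sel y *: w))).
  rewrite !normrZ (ger0_norm t0) (ger0_norm u0) -(ler_pM2l K0) /psi; lra.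
have psi_ge x a : E x a -> a0 - W + (K - P) * `|x - (v + sel x *: w)| <= a + psi x.
  move=> Ex; have := minE _ _ Ex; have [/andP[s0 s1] _] := selP x.
  have := dual_bound_ge (x - (v + sel x *: w)) pP.
  have := dual_bound_ge v pP; have := dual_bound_ge w pP.
  have : sel x * m <= `|m|.
    apply: le_trans (ler_norm _) _.
    by rewrite normrM ger0_norm// ler_piMl.
  have : sel x * (P * `|w|) <= P * `|w|.
    by rewrite ler_piMl// mulr_ge0// ltW.
  move=> h1 h2 /(ler_wpM2l s0) h3 h4 h5.
  have px : pairing x p = pairing v p + sel x * pairing w p +
      pairing (x - (v + sel x *: w)) p by rewrite !pairingE; ring.
  rewrite /psi /W; lra.
pose k := Num.min K (n / (`|w| + 1)).
have w1 : 0 < `|w| + 1 by rewrite ltr_wpDl.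
have k0 : 0 < k by rewrite /k lt_min K0 divr_gt0.
have kK : k <= K by rewrite /k ge_min lexx.
have kw : k * `|w| <= n.
  have : k <= n / (`|w| + 1) by rewrite /k ge_min lexx orbT.
  rewrite ler_pdivlMr//; lra.
pose E' x a := E x (a - psi x).
have psiv : psi v <= 0.
  have := psile v 0; rewrite lexx ler01 => /(_ isT).
  by rewrite scale0r addr0 subrr normr0 mulr0 mul0r subrr.
have [||||x [a [Ex aa0 xmin]]] := @ekeland R X E' v a0 (a0 - W) k _ _ _ _ k0.
- by move=> x a b Ex ab; apply: upE Ex _; rewrite lerD2r.
- move=> x a h; apply: clE => d d0.
  pose d' := d / (K + 1).
  have K1 : 0 < K + 1 by rewrite addr_gt0.
  have d'0 : 0 < d' by rewrite divr_gt0.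
  have d'd : d' <= d by rewrite ler_pdivrMr// ler_peMr ?(ltW d0)// lerDr ltW.
  have [y [yx Ey]] := h _ d'0; exists y; split; first exact: lt_le_trans d'd.
  apply: upE Ey _; have := psiL y x.
  have : (K + 1) * d' = d by rewrite /d' mulrC divfK ?gt_eqF.
  rewrite distrC; move: yx; rewrite -(ltr_pM2l K0); lra.
- move=> x a /psi_ge; rewrite subrK; apply: le_trans.
  by rewrite lerDl mulr_ge0// subr_ge0 ltW.
- by apply: upE Ev _; lra.
pose y := v + sel x *: w; pose s := sel x.
have xy : `|x - y| < n'.
  have := psi_ge _ _ Ex; rewrite subrK => h.
  have KPE : K - P = (`|W| + 1) / n' by rewrite /K; ring.
  have : (K - P) * `|x - y| <= W by rewrite /y; lra.
  rewrite KPE mulrAC ler_pdivrMr// => h2.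
  rewrite -(ltr_pM2l (_ : 0 < `|W| + 1)) ?ltr_wpDl//.
  apply: le_lt_trans h2 _; rewrite ltr_pM2r//.
  by apply: le_lt_trans (ler_norm _) _; rewrite ltrDl.
have [/andP[s0 s1] _] := selP x.
have s_lt1 : s < 1.
  rewrite lt_neqAle s1 andbT; apply/eqP => sE.
  have ye : y = e by rewrite /y -/s sE /w; vlin R; ring.
  have xe : `|x - e| < z.
    rewrite -ye; apply: lt_trans xy _; rewrite /n' gt_min; apply/orP; right.
    by rewrite ltr_pdivrMr// ltr_pMr// ltr1n.
  apply: (zP x xe); apply: upE Ex _.
  rewrite /psi -/y -/s sE /m.
  have : 0 <= K * `|x - y| by rewrite mulr_ge0// ltW.
  lra.
pose G (u : X) (b : R) : Prop := psi u + k * `|u - x| - a <= b.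
have [||||||l hl] := @sandwich R X E G x (a - psi x) (psi x + (K + k) - a) 1.
- exact: cE.
- move=> u b u' b' t t01 Gu Gu'; have := psiC u u' t t01; rewrite /G.
  move/andP: t01 => [t0 t1]; have u0 : 0 <= 1 - t by rewrite subr_ge0.
  have -> : t *: u + (1 - t) *: u' - x = t *: (u - x) + (1 - t) *: (u' - x).
    by vlin R; ring.
  have := ler_normD (t *: (u - x)) ((1 - t) *: (u' - x)).
  rewrite !normrZ (ger0_norm t0) (ger0_norm u0) -(ler_pM2l k0).
  have := ler_wpM2l t0 Gu; have := ler_wpM2l u0 Gu'; lra.
- move=> u b b' Eu Gu; have := xmin u (b + psi u).
  rewrite /E' addrK => /(_ Eu); move: Gu; rewrite /G; lra.
- exact: Ex.
- exact: ltr01.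
- move=> h h1; have hE : x + h - x = h by vlin R; ring.
  rewrite /G hE; have := psiL x (x + h); rewrite hE.
  have : K * `|h| <= K by rewrite ler_piMr ?ltW.
  have : k * `|h| <= k by rewrite ler_piMr ?ltW.
  lra.
have Gx u : G u (psi u + k * `|u - x| - a) by exact: lexx.
have lu u : pairing (u - x) l <= psi u + k * `|u - x| - psi x.
  by have := hl _ _ _ _ Ex (Gx u); lra.
exists s, x, (- l); split; rewrite ?s0//.
- by apply: le_trans (ltW xy) _; rewrite /n' ge_min lexx.
- exists (a - psi x); split=> // u b Eu.
  have := hl _ _ _ _ Eu (Gx x).
  by rewrite subrr normr0 mulr0 !pairingE; lra.
- have := lu y; have := psile y s; rewrite s0 s1 => /(_ isT).
  rewrite subrr normr0 mulr0 !pairingNr {3}/psi -/y -/s distrC.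
  have : k * `|x - y| <= K * `|x - y| by rewrite ler_wpM2r.
  rewrite -/w -/y; lra.
- have := lu (x + (1 - s) *: w); have := psile (x + (1 - s) *: w) 1.
  rewrite ler01 lexx => /(_ isT).
  have -> : x + (1 - s) *: w - (v + 1 *: w) = x - y.
    by rewrite /y -/s; vlin R; ring.
  have -> : x + (1 - s) *: w - x = (1 - s) *: w by vlin R; ring.
  have u0 : 0 < 1 - s by rewrite subr_gt0.
  rewrite {3}/psi -/y -/s normrZ (gtr0_norm u0) pairingZl pairingNr -/w -/m.
  move=> h1 h2; have : (1 - s) * pairing w l <= (1 - s) * (k * `|w| - m) by lra.
  rewrite (ler_pM2l u0); lra.
Qed.

End ApproximateMeanValue.

(** * Maximally monotone operators near interior points of the domain *)

Section MaximalMonotone.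
Context {R : realType} {X : completeNormedModType R}.
Variable B : X -> set (dual X).
Implicit Types (a b c d e t K M : R) (x y z u : X).

(** A pair satisfying the hypothesis of the second clause could be added to the
    graph without losing monotonicity. *)
Definition max_mono := (forall x xs y ys, B x xs -> B y ys ->
    0 <= pairing (x - y) (xs - ys)) /\
  (forall x xs, (forall y ys, B y ys -> 0 <= pairing (x - y) (xs - ys)) ->
    B x xs).

(** The convex hull of the points [(x, xs, <x, xs>)] with [xs] in [B x]. Up to
    closure it is the epigraph of the largest convex function on pairs that is at
    most the pairing on the graph. *)
Inductive graph_hull : X -> dual X -> R -> Prop :=
| graph_hull_base x xs : B x xs -> graph_hull x xs (pairing x xs)
| graph_hull_conv x xs a y ys b t : 0 <= t <= 1 ->
    graph_hull x xs a -> graph_hull y ys b ->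
    graph_hull (t *: x + (1 - t) *: y) (t *: xs + (1 - t) *: ys)
      (t * a + (1 - t) * b).

Hypothesis mB : max_mono.

Lemma graph_hull_ge x xs a y ys : graph_hull x xs a -> B y ys ->
  pairing x ys + pairing y xs - pairing y ys <= a.
Proof.
move=> + By; elim=> {x xs a} [x xs Bx|x xs a x' xs' a' t /andP[t0 t1] _ IH _ IH'].
  by have := mB.1 _ _ _ _ Bx By; rewrite !pairingE; lra.
have u0 : 0 <= 1 - t by rewrite subr_ge0.
have := ler_wpM2l t0 IH; have := ler_wpM2l u0 IH'; rewrite !pairingE; lra.
Qed.

Lemma graph_hull_monotone x xs a y ys b : graph_hull x xs a -> graph_hull y ys b ->
  pairing x ys + pairing y xs <= a + b.
Proof.
move=> + hy; elim=> {x xs a} [x xs Bx|x xs a x' xs' a' t /andP[t0 t1] _ IH _ IH'].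
  by have := graph_hull_ge hy Bx; lra.
have u0 : 0 <= 1 - t by rewrite subr_ge0.
have := ler_wpM2l t0 IH; have := ler_wpM2l u0 IH'; rewrite !pairingE; lra.
Qed.

Lemma graph_hull_pairing x xs a : graph_hull x xs a -> pairing x xs <= a.
Proof. by move=> h; have := graph_hull_monotone h h; lra. Qed.

(** The epigraph of [y |-> inf (b - <x, ys>)], the infimum being over the points
    [(y, ys, b)] of the hull. Its affine minorants vanishing at [x] are the
    elements of [B x], so that membership in [B x] is a separation problem. *)
Definition hull_gap x y c :=
  exists ys b, graph_hull y ys b /\ b - pairing x ys <= c.

Lemma hull_gap_convex x : convex_rel (hull_gap x).
Proof.
move=> y a z b t t01 [ys [c [hy yc]]] [zs [e [hz ze]]].
exists (t *: ys + (1 - t) *: zs), (t * c + (1 - t) * e); split.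
  exact: graph_hull_conv.
have /andP[t0 t1] := t01; have u0 : 0 <= 1 - t by rewrite subr_ge0.
have := ler_wpM2l t0 yc; have := ler_wpM2l u0 ze; rewrite !pairingE; lra.
Qed.

Lemma hull_gap_base x y ys : B y ys -> hull_gap x y (pairing (y - x) ys).
Proof.
move=> By; exists ys, (pairing y ys); split; first exact: graph_hull_base.
by rewrite !pairingE; lra.
Qed.

Lemma mem_of_hull_gap x xs :
  (forall y c, hull_gap x y c -> pairing (y - x) xs <= c) -> B x xs.
Proof.
move=> h; apply: mB.2 => y ys By; have := h _ _ (hull_gap_base x By).
rewrite !pairingE; lra.
Qed.

(** Demiclosedness: bounded values along points tending to [x] put [x] in the
    domain. The bound [K] makes [K |y - x|] a majorant of minus the gap
    function, which replaces weak-star compactness. *)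
Lemma mem_dom_of_bounded x (K : R) : 0 < K ->
  (forall e : R, 0 < e -> exists v w, [/\ B v w, `|v - x| < e & dual_bound w K]) ->
  B x !=set0.
Proof.
move=> K0 h.
pose F (y : X) (b : R) : Prop := K * `|y - x| <= b.
have [v0 [w0 [Bv0 _ _]]] := h 1 ltr01.
have [||||||l hl] := @sandwich R X (hull_gap x) F v0 (pairing (v0 - x) w0)
    (K * (`|v0 - x| + 1)) 1.
- exact: hull_gap_convex.
- move=> y a z b t /andP[t0 t1] Fy Fz; have u0 : 0 <= 1 - t by rewrite subr_ge0.
  rewrite /F; have -> : t *: y + (1 - t) *: z - x =
      t *: (y - x) + (1 - t) *: (z - x) by vlin R; ring.
  have := ler_normD (t *: (y - x)) ((1 - t) *: (z - x)).
  rewrite !normrZ (ger0_norm t0) (ger0_norm u0) => /(ler_wpM2l (ltW K0)).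
  have := ler_wpM2l t0 Fy; have := ler_wpM2l u0 Fz; lra.
- move=> y a b [ys [c [hy ca]]] Fy; have [P P0 Pys] := dual_bounded ys.
  suff : 0 <= a + K * `|y - x| by move: Fy; rewrite /F; lra.
  apply/ler_addgt0Pr => e e0.
  have [v [w [Bv vx Kw]]] := h (e / (K + P)) (divr_gt0 e0 (addr_gt0 K0 P0)).
  have := graph_hull_ge hy Bv.
  have := dual_bound_ge (y - v) Kw; have := dual_bound_ge (v - x) Pys.
  move: vx; rewrite ltr_pdivlMr ?addr_gt0// mulrC mulrDl => vx.
  have := ler_distD x y v; rewrite (distrC x v) -(ler_pM2l K0) !pairingE; lra.
- exact: hull_gap_base.
- exact: ltr01.
- move=> k k1; rewrite /F ler_pM2l//; have -> : v0 + k - x = (v0 - x) + k.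
    by vlin R; ring.
  by apply: le_trans (ler_normD _ _) _; rewrite lerD2l ltW.
exists (- l); apply: mem_of_hull_gap => y c hy.
have := hl _ _ x 0 hy; rewrite /F subrr normr0 mulr0 => /(_ (lexx 0)).
by rewrite !pairingE; lra.
Qed.

Definition bounded_ball x d M := forall h, `|h| <= d ->
  B (x + h) !=set0 /\ forall xs, B (x + h) xs -> dual_bound xs M.

(** Monotonicity turns a bound on a ball around [u] into a bound on [ys] at an
    arbitrary point [y] of the domain in terms of the single number
    [<y - u, ys>]. *)
Lemma bounded_ball_coercive u d M y ys : 0 < d -> 0 <= M ->
  bounded_ball u d M -> B y ys -> exists N, [/\ 0 <= N, dual_bound ys N &
    N * d = pairing (y - u) ys + M * (`|y - u| + d)].
Proof.
move=> d0 M0 hu By.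
have hN h : `|h| <= d ->
    pairing h ys <= pairing (y - u) ys + M * (`|y - u| + d).
  move=> hd; have [[us Bus] /(_ us Bus) ub] := hu h hd.
  have := mB.1 _ _ _ _ By Bus; have := dual_bound_ge (y - (u + h)) ub.
  have -> : y - (u + h) = (y - u) - h by vlin R; ring.
  have : M * `|y - u - h| <= M * (`|y - u| + d).
    by rewrite ler_wpM2l//; apply: le_trans (ler_normB _ _) _; rewrite lerD2l.
  rewrite !pairingE; lra.
exists ((pairing (y - u) ys + M * (`|y - u| + d)) / d).
rewrite divfK ?gt_eqF//; split=> //.
  by have := hN 0; rewrite normr0 pairing0l ltW// => /(_ isT); rewrite pmulr_lge0 ?invr_gt0.
by apply: (@dual_bound_ball _ _ _ d) => // h hd; rewrite divfK ?gt_eqF// hN.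
Qed.

Lemma bounded_ballW u d M d' M' : d' <= d -> M <= M' -> bounded_ball u d M ->
  bounded_ball u d' M'.
Proof.
move=> dd MM hu h hd; have [Bn b] := hu h (le_trans hd dd).
by split=> // xs /b; exact: dual_boundW.
Qed.

(** Baire category applied to the sublevel sets of the convex function
    [x |-> sup <x - y, ys> / (1 + |y|)], the supremum being over the graph: it is
    finite on the domain by monotonicity. *)
Lemma locally_bounded x d : 0 < d -> (forall h, `|h| < d -> B (x + h) !=set0) ->
  exists d' M, [/\ 0 < d', 0 < M & bounded_ball x d' M].
Proof.
move=> d0 dB.
pose S n := [set u : X | forall y ys, B y ys ->
  pairing (u - y) ys <= n%:R * (1 + `|y|)].
have y1 (y : X) : 0 < 1 + `|y| by rewrite ltr_pwDl.
have Sle n k u : (n <= k)%N -> S n u -> S k u.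
  move=> nk Sn y ys By; apply: le_trans (Sn y ys By) _.
  by rewrite ler_pM2r// ler_nat.
have Sdom u us : B u us -> exists n, S n u.
  move=> Bu; have [N N0 Nus] := dual_bounded us.
  exists (Num.truncn (N * (1 + `|u|))).+1 => y ys By.
  apply: (@le_trans _ _ (N * (1 + `|u|) * (1 + `|y|))); last first.
    by rewrite ler_pM2r// ltW// truncnS_gt.
  have := mB.1 _ _ _ _ Bu By; have := Nus (u - y).
  have : N * `|u - y| <= N * (1 + `|u|) * (1 + `|y|).
    rewrite -mulrA ler_pM2l//; apply: le_trans (ler_normB _ _) _.
    have : 0 <= `|u| * `|y| by rewrite mulr_ge0.
    lra.
  rewrite !pairingE; lra.
have opS n : open (~` S n).
  rewrite openE => u /existsNP[y /existsNP[ys /not_implyP[By /negP]]].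
  rewrite -ltNge => lt; have [N N0 Nys] := dual_bounded ys.
  pose r : R := pairing (u - y) ys - n%:R * (1 + `|y|).
  have r0 : 0 < r by rewrite subr_gt0.
  apply/nbhs_ballP; exists (r / N); first by rewrite /= divr_gt0.
  move=> z; rewrite -ball_normE /ball_/= ltr_pdivlMr// mulrC => uz /(_ _ _ By).
  have := Nys (u - z); rewrite /r in uz; rewrite !pairingE in uz *; lra.
have [n Sn] : exists n, ~ dense (~` S n).
  apply/existsNP => dS.
  have := @Baire R X (fun n => ~` S n) (fun n => conj (opS n) (dS n)).
  have [z0 oz] : ball x d !=set0 /\ open (ball x d).
    by split; [exists x; exact: ballxx|exact: ball_open].
  move=> /(_ _ z0 oz)[u [xu uS]].
  have : B (x + (u - x)) !=set0.
    by apply: dB; move: xu; rewrite -ball_normE /ball_/= distrC.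
  rewrite addrC subrK => -[us /Sdom[k Sk]].
  exact: (uS k I).
have [z [r r0 zr]] : exists z, exists2 r : R, 0 < r & forall h, `|h| < r -> S n (z + h).
  move/denseNE: Sn => [O [[z /open_nbhs_nbhs /nbhs_ballP[r /= r0 zr]] O0]].
  exists z, r => // h hr; apply: contrapT => nS.
  have Oz : O (z + h).
    by apply: zr; rewrite -ball_normE /ball_/= opprD addrA subrr sub0r normrN.
  by have : (O `&` ~` S n) (z + h) by []; rewrite O0.
(* [x] lies strictly between [z], the centre of a ball in a sublevel set, and a *)
(* point [x + g (x - z)] of the domain: by convexity a smaller ball around [x] *)
(* lies in a sublevel set too. *)
pose q : R := `|x - z| + 1; pose g : R := Num.min (d / 2) 1 / q.
have q0 : 0 < q by rewrite ltr_wpDl.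
have m0 : 0 < Num.min (d / 2) 1 by rewrite lt_min divr_gt0//= ltr01.
have g0 : 0 < g by rewrite divr_gt0.
have gx : g * `|x - z| < d.
  have : g * `|x - z| <= Num.min (d / 2) 1.
    by rewrite /g mulrAC ler_pdivrMr// ler_pM2l// lerDl ler01.
  move/le_lt_trans; apply; rewrite gt_min; apply/orP; left.
  by rewrite ltr_pdivrMr// ltr_pMr// ltr1n.
have [us /Sdom[k Sk]] : B (x + g *: (x - z)) !=set0.
  by apply: dB; rewrite normrZ gtr0_norm.
have g1 : 0 < 1 + g by rewrite addr_gt0.
pose s : R := g / (1 + g).
have s0 : 0 < s by rewrite divr_gt0.
have s1 : 0 < 1 - s.
  have -> : 1 - s = (1 + g)^-1 by rewrite /s; field; rewrite gt_eqF.
  by rewrite invr_gt0.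
pose j := maxn n k.
have Sj h : `|h| < s * r -> S j (x + h).
  move=> hr y ys By.
  have zh : `|s^-1 *: h| < r.
    by rewrite normrZ gtr0_norm ?invr_gt0// mulrC ltr_pdivrMr// mulrC.
  have h1 := Sle _ _ _ (leq_maxl n k) (zr _ zh) _ _ By.
  have h2 := Sle _ _ _ (leq_maxr n k) Sk _ _ By.
  have -> : x + h - y = s *: (z + s^-1 *: h - y) +
      (1 - s) *: (x + g *: (x - z) - y).
    by vlin R; rewrite /s; field; rewrite ?gt_eqF.
  rewrite pairingDl !(pairingZl _ (_ - y)).
  by have := ler_wpM2l (ltW s0) h1; have := ler_wpM2l (ltW s1) h2; rewrite -/j; lra.
pose e : R := s * r / 3.
have sr0 : 0 < s * r by rewrite mulr_gt0.
have e0 : 0 < e by rewrite divr_gt0.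
have e3 : s * r = e * 3 by rewrite /e divfK.
have M0 : 0 < (j%:R + 1) * (1 + (`|x| + e)) / e.
  have xe0 : 0 <= `|x| + e by rewrite addr_ge0// ltW.
  have j0 : 0 <= j%:R :> R by [].
  by rewrite divr_gt0// mulr_gt0//; lra.
exists (Num.min e (d / 2)), ((j%:R + 1) * (1 + (`|x| + e)) / e).
split=> //; first by rewrite lt_min e0 divr_gt0.
move=> h; rewrite le_min => /andP[he hd]; split.
  by apply: dB; apply: le_lt_trans hd _; rewrite ltr_pdivrMr// ltr_pMr// ltr1n.
move=> xs Bx; apply: (@dual_bound_ball _ _ _ e) => // h' h'e.
rewrite divfK ?gt_eqF//.
have hh : `|h + h'| < s * r.
  by apply: le_lt_trans (ler_normD _ _) _; rewrite e3; lra.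
have := Sj _ hh _ _ Bx.
have -> : x + (h + h') - (x + h) = h' by vlin R; ring.
move=> h1; apply: le_trans h1 _.
have xe : 1 + `|x + h| <= 1 + (`|x| + e).
  by rewrite lerD2l; apply: le_trans (ler_normD _ _) _; rewrite lerD2l.
apply: le_trans (ler_wpM2l (ler0n _ _) xe) _.
by rewrite ler_wpM2r// ?lerDl// addr_ge0// addr_ge0// ltW.
Qed.

(** Let [x] be the point of the segment. The gap function of [x] is nonnegative at
    [x] by monotonicity and bounded above near [x], because [u] is interior and
    [t] is positive; hence it has a linear minorant in [y - x], and this is an
    element of [B x]. *)
Lemma segment_in_dom y ys b u d M t : 0 < d -> 0 <= M -> bounded_ball u d M ->
  graph_hull y ys b -> 0 < t <= 1 -> B ((1 - t) *: y + t *: u) !=set0.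
Proof.
move=> d0 M0 hu hy /andP[t0 t1]; set x := _ + _.
have v0 : 0 <= 1 - t by rewrite subr_ge0.
pose F (z : X) (c : R) := z = x /\ 0 <= c.
pose N : R := (1 - t) * (b - pairing x ys) + t * (M * (`|u - x| + d)).
have [||||||l hl] := @sandwich R X F (hull_gap x) x 0 N (t * d).
- move=> z a z' c s /andP[s0 s1] [-> a0] [-> c0]; split.
    by vlin R; ring.
  by rewrite addr_ge0// mulr_ge0// subr_ge0.
- exact: hull_gap_convex.
- move=> z a c [-> a0] [zs [e [/graph_hull_pairing hz ec]]]; lra.
- by split.
- exact: mulr_gt0.
- move=> h hd.
  have hd' : `|t^-1 *: h| <= d.
    by rewrite normrZ gtr0_norm ?invr_gt0// mulrC ler_pdivrMr// mulrC ltW.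
  have [[ws Bw] /(_ _ Bw) bw] := hu _ hd'; set w := u + _ in Bw.
  have -> : x + h = (1 - t) *: y + (1 - (1 - t)) *: w.
    by rewrite /x /w; vlin R; field; rewrite gt_eqF.
  exists ((1 - t) *: ys + (1 - (1 - t)) *: ws),
    ((1 - t) * b + (1 - (1 - t)) * pairing w ws); split.
    apply: graph_hull_conv => //; first by rewrite v0 gerBl ltW.
    exact: graph_hull_base.
  have : pairing (w - x) ws <= M * (`|u - x| + d).
    apply: le_trans (bw _) _; rewrite ler_wpM2l//.
    have -> : w - x = (u - x) + t^-1 *: h by rewrite /w; vlin R; ring.
    by apply: le_trans (ler_normD _ _) _; rewrite lerD2l.
  by rewrite -(ler_pM2l t0) /N !pairingE; lra.
exists l; apply: mem_of_hull_gap => z c hz.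
by have := hl x 0 z c (conj erefl (lexx 0)) hz; rewrite add0r.
Qed.

Definition closed_dom x := forall e, 0 < e -> exists2 y, `|y - x| < e & B y !=set0.

(** Quantitative form of the fact that the segment from a point of the closure
    of the domain to an interior point is interior. *)
Lemma closed_dom_ball y u d M t h : 0 < d -> 0 <= M -> bounded_ball u d M ->
  closed_dom y -> 0 < t <= 1 -> `|h| <= t * (d / 4) ->
  B ((1 - t) *: y + t *: u + h) !=set0.
Proof.
move=> d0 M0 hu cy /andP[t0 t1] hd.
have e0 : 0 < t * (d / 4) by rewrite mulr_gt0// divr_gt0.
have [y' yy' [ys By]] := cy _ e0.
pose k := t^-1 *: (h + (1 - t) *: (y - y')).
have -> : (1 - t) *: y + t *: u + h = (1 - t) *: y' + t *: (u + k).
  by rewrite /k; vlin R; field; rewrite gt_eqF.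
have kd : `|k| <= d / 2.
  rewrite /k normrZ gtr0_norm ?invr_gt0// mulrC ler_pdivrMr// mulrC.
  apply: le_trans (ler_normD _ _) _; rewrite normrZ (distrC y).
  rewrite (@ger0_norm _ (1 - t)) ?subr_ge0//.
  have : (1 - t) * `|y' - y| <= `|y' - y| by rewrite ler_piMl// gerBl ltW.
  lra.
apply: (@segment_in_dom _ ys (pairing y' ys) (u + k) (d / 2) M); rewrite ?t0 ?divr_gt0//.
  move=> k' k'd; rewrite -addrA; apply: hu.
  by apply: le_trans (ler_normD _ _) _; lra.
exact: graph_hull_base.
Qed.

Lemma closed_dom_bounded y u d M t : 0 < d -> 0 <= M -> bounded_ball u d M ->
  closed_dom y -> 0 < t <= 1 ->
  exists d' M', [/\ 0 < d', 0 < M' & bounded_ball ((1 - t) *: y + t *: u) d' M'].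
Proof.
move=> d0 M0 hu cy t01; apply: (@locally_bounded _ (t * (d / 4))).
  by rewrite mulr_gt0 ?divr_gt0//; case/andP: t01.
by move=> h hd; apply: (closed_dom_ball d0 M0 hu cy t01); exact: ltW.
Qed.

Lemma mem_closed_dom x : B x !=set0 -> closed_dom x.
Proof. by move=> Bx e e0; exists x => //; rewrite subrr normr0. Qed.

Lemma closed_dom_convex u d M : 0 < d -> 0 <= M -> bounded_ball u d M ->
  forall x y t, 0 <= t <= 1 -> closed_dom x -> closed_dom y ->
  closed_dom (t *: x + (1 - t) *: y).
Proof.
move=> d0 M0 hu x y t t01 cx cy e e0.
pose A := `|u| + `|x| + `|y| + 1.
have A0 : 0 < A by rewrite ltr_wpDl// !addr_ge0.
pose s := Num.min 1 (e / (2 * A)).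
have s0 : 0 < s by rewrite lt_min ltr01 divr_gt0// mulr_gt0.
have s01 : 0 < s <= 1 by rewrite s0 ge_min lexx.
have sA : s * A < e.
  have : s * (2 * A) <= e by rewrite -ler_pdivlMr ?mulr_gt0// ge_min lexx orbT.
  have : 0 < s * A by rewrite mulr_gt0.
  lra.
have [d' [M' [d'0 M'0 hy]]] := closed_dom_bounded d0 M0 hu cy s01.
have [d2 [M2 [d20 M20 hx]]] := closed_dom_bounded d0 M0 hu cx s01.
have [xs Bx] : B ((1 - s) *: x + s *: u) !=set0.
  by have := hx 0; rewrite normr0 addr0 => /(_ (ltW d20))[].
have [ys By] : B ((1 - s) *: y + s *: u) !=set0.
  by have := hy 0; rewrite normr0 addr0 => /(_ (ltW d'0))[].
exists (t *: ((1 - s) *: x + s *: u) + (1 - t) *: ((1 - s) *: y + s *: u)).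
  have -> : t *: ((1 - s) *: x + s *: u) + (1 - t) *: ((1 - s) *: y + s *: u) -
     (t *: x + (1 - t) *: y) = s *: (u - (t *: x + (1 - t) *: y)).
    by vlin R; ring.
  rewrite normrZ gtr0_norm//; apply: le_lt_trans sA; rewrite ler_pM2l//.
  apply: le_trans (ler_normB _ _) _.
  have /andP[t0 t1] := t01.
  have := ler_normD (t *: x) ((1 - t) *: y); rewrite !normrZ (ger0_norm t0).
  rewrite (@ger0_norm _ (1 - t)) ?subr_ge0//.
  have : t * `|x| <= `|x| by rewrite ler_piMl.
  have : (1 - t) * `|y| <= `|y| by rewrite ler_piMl// gerBl.
  rewrite /A; lra.
have [t0|t0] := eqVneq t 1.
  by exists xs; rewrite t0 scale1r subrr scale0r addr0.
have -> : t = 1 - (1 - t) by ring.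
have -> : 1 - (1 - (1 - t)) = 1 - t by ring.
apply: (segment_in_dom d'0 (ltW M'0) hy (graph_hull_base Bx)).
by have /andP[t0' t1] := t01; rewrite subr_gt0 lt_neqAle t0 t1 gerBl.
Qed.

Lemma bounded_ball_common3 x y z d1 M1 d2 M2 d3 M3 :
  0 < d1 -> 0 < M1 -> 0 < d2 -> 0 < d3 ->
  bounded_ball x d1 M1 -> bounded_ball y d2 M2 -> bounded_ball z d3 M3 ->
  exists d M, [/\ 0 < d, 0 < M, bounded_ball x d M, bounded_ball y d M &
    bounded_ball z d M].
Proof.
move=> d10 M10 d20 d30 bx by_ bz.
exists (Num.min d1 (Num.min d2 d3)), (Num.max M1 (Num.max M2 M3)); split.
- by rewrite !lt_min d10 d20.
- by rewrite lt_max M10.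
- by apply: bounded_ballW bx; rewrite ?ge_min ?le_max lexx.
- by apply: bounded_ballW by_; rewrite ?ge_min ?le_max lexx !orbT.
- by apply: bounded_ballW bz; rewrite ?ge_min ?le_max lexx !orbT.
Qed.

End MaximalMonotone.

(** * Operators monotonically related to the origin *)

Section MonotonicallyRelated.
Context {R : realType} {X : completeNormedModType R}.
Variables (E : X -> R -> Prop) (B : X -> set (dual X)) (p : dual X) (c0 : R).
Hypothesis cE : convex_rel E.
Hypothesis upE : upward_rel E.
Hypothesis clE : closed_rel E.
Hypothesis minE : forall x a, E x a -> pairing x p + c0 <= a.
Hypothesis mB : max_mono B.
Hypothesis related0 : forall x xs ys, subgrad E x xs -> B x ys ->
  0 <= pairing x (xs + ys).
Implicit Types (a b c d e t r s n K M N : R) (x y z u v : X).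

(** Integrated form of the hypothesis along the ray through [y]. If the value at
    [t y] were larger, the approximate mean value theorem would give points [x]
    close to [s y], [t <= s <= 1], and subgradients [xs] with
    [<x, xs> < - s <y, w>]; monotonicity between [x] and [r y] makes the values
    of [B x] at [y] almost at most [<y, w>], which contradicts the hypothesis.
    Placing [w] at [r y] with [1 < r] keeps a margin also for [s = 1], and it
    bounds the elements of [B x] uniformly. *)
Lemma radial_estimate y a t r w d M : 0 < t < 1 -> 1 < r -> 0 < d -> 0 < M ->
  E y a -> bounded_ball B y d M -> bounded_ball B (t *: y) d M ->
  bounded_ball B (r *: y) d M -> B (r *: y) w ->
  E (t *: y) (a + (1 - t) * pairing y w).
Proof.
move=> /andP[t0 t1] r1 d0 M0 Ey By Bty Bry Bw; apply: contrapT => nE.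
have [k k0 nEk] : exists2 k, 0 < k & ~ E (t *: y) (a + (1 - t) * pairing y w + k).
  apply: contra_notP nE => h; apply: clE => e e0; exists (t *: y).
  rewrite subrr normr0 e0; split=> //; apply: contrapT => nEe.
  by apply: h; exists e.
have r0 : 0 < r by exact: lt_trans r1.
have wM : dual_bound w M.
  by have := Bry 0; rewrite normr0 addr0 => /(_ (ltW d0))[_]; exact.
pose L := `|y|.
have L0 : 0 <= L by exact: normr_ge0.
(* [N0] bounds the elements of [B x] for every admissible [x]; the distance [n] *)
(* to the segment is then chosen so small that the error terms, of size *)
(* [n * D], do not exceed a fraction of the gap [k]. *)
pose N0 := 2 * (2 * r * M * L + M * (1 + d)) / d.
have N00 : 0 <= N0.
  have h1 : 0 <= r * M * L by rewrite !mulr_ge0// ltW.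
  have h2 : 0 < M * (1 + d) by rewrite mulr_gt0// addr_gt0.
  by rewrite /N0 divr_ge0 ?(ltW d0)//; lra.
pose q := (r - 1) * t * k.
have q0 : 0 < q by rewrite !mulr_gt0// subr_gt0.
pose D := r * N0 + M.
have D0 : 0 < D by rewrite ltr_wpDl// mulr_ge0// ltW.
pose n := Num.min (Num.min (k / 2) (d / 2)) (Num.min 1 (Num.min (d * t / (2 * r)) (q / (4 * D)))).
have n0 : 0 < n by rewrite !lt_min ltr01 !divr_gt0// !mulr_gt0.
have nk : n <= k / 2 by rewrite !ge_min lexx.
have nd : n <= d / 2 by rewrite !ge_min lexx !orbT.
have n1 : n <= 1 by rewrite !ge_min lexx !orbT.
have nr : n * (2 * r) <= d * t.
  by rewrite -ler_pdivlMr ?mulr_gt0// !ge_min lexx !orbT.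
have nq : n * (4 * D) <= q.
  by rewrite -ler_pdivlMr ?mulr_gt0// !ge_min lexx !orbT.
have [s [x [xs [/andP[s0 s1] xn sx dx slope]]]] :=
  approx_mean_value cE upE clE minE Ey nEk n0.
pose g := 1 - s * (1 - t).
have tg : t <= g.
  have : s * (1 - t) <= 1 - t by rewrite ler_piMl ?subr_ge0 ?ltW.
  rewrite /g; lra.
have g1 : g <= 1 by rewrite gerBl mulr_ge0// subr_ge0 ltW.
have gy : y + s *: (t *: y - y) = g *: y by rewrite /g; vlin R; ring.
rewrite gy in xn dx; pose e := x - g *: y.
have en : `|e| <= n by [].
have xE : x = g *: y + e by rewrite /e; vlin R; ring.
have [b Bx] : B x !=set0.
  have -> : x = (1 - s) *: (y + e) + s *: (t *: y + e).
    by rewrite xE /g; vlin R; ring.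
  have [[b Bb] _] : B (y + e) !=set0 /\ forall xs, B (y + e) xs -> dual_bound xs M.
    by apply: By; apply: le_trans en _; lra.
  have [s00|s00] := eqVneq s 0.
    by exists b; rewrite s00 subr0 scale1r scale0r addr0.
  apply: (@segment_in_dom _ _ _ mB _ b (pairing (y + e) b) _ (d / 2) M).
  - by rewrite divr_gt0.
  - exact: ltW.
  - move=> h hd; rewrite -addrA; apply: Bty.
    by apply: le_trans (ler_normD _ _) _; lra.
  - exact: graph_hull_base.
  - by rewrite lt_neqAle eq_sym s00 s0 ltW.
have [N [N_ge0 bN NE]] := bounded_ball_coercive mB d0 (ltW M0) Bry Bx.
have eb : pairing e b <= n * N.
  by apply: le_trans (bN _) _; rewrite mulrC ler_wpM2r.
have ew : - (n * M) <= pairing e w.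
  apply: le_trans (dual_bound_ge e wM).
  by rewrite lerN2 mulrC ler_wpM2r// ltW.
have rel := related0 sx Bx.
have mono := mB.1 _ _ _ _ Bw Bx.
set yb := pairing y b; set yw := pairing y w; set yxs := pairing y xs.
have xb : pairing x b = g * yb + pairing e b by rewrite {1}xE !pairingE.
have g0 : 0 < g by exact: lt_le_trans tg.
have t1' : 0 < 1 - t by rewrite subr_gt0.
have yxs_le : yxs <= - yw - k / 2.
  have h : (1 - t) * (yxs + yw) <= - (k / 2).
    move: slope; rewrite !pairingE -/yw -/yxs; lra.
  have : (1 - t) * (yxs + yw) <= (1 - t) * - (k / 2).
    by apply: le_trans h _; nra.
  rewrite ler_pM2l//; lra.
have xb_ge : g * yw + t * (k / 2) <= g * yb + pairing e b.
  rewrite -xb; move: rel dx; rewrite !pairingE -/yxs => rel dx.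
  have : g * yxs <= g * (- yw - k / 2) by rewrite ler_pM2l.
  have : t * (k / 2) <= g * (k / 2) by rewrite ler_pM2r ?divr_gt0.
  lra.
have yb_le : (r - g) * yb <= (r - g) * yw + pairing e b - pairing e w.
  by move: mono; rewrite xE !pairingE -/yb -/yw; lra.
have key : (r - 1) * (t * (k / 2)) <= r * (n * N) + n * M.
  have rg : 0 < r - g by lra.
  have h1 := ler_wpM2l (ltW rg) xb_ge; have h2 := ler_wpM2l (ltW g0) yb_le.
  have h3 : (r - 1) * (t * (k / 2)) <= (r - g) * (t * (k / 2)).
    by rewrite ler_pM2r ?mulr_gt0 ?divr_gt0//; lra.
  have h4 : r * pairing e b <= r * (n * N) by rewrite ler_pM2l.
  have h5 : - (g * pairing e w) <= n * M.
    have : g * - pairing e w <= g * (n * M) by rewrite ler_pM2l//; lra.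
    have : g * (n * M) <= n * M by rewrite ler_piMl// mulr_ge0// ltW.
    lra.
  lra.
have NN0 : N <= N0.
  have xr : `|x - r *: y| <= r * L + n.
    have -> : x - r *: y = - (r - g) *: y + e by rewrite xE; vlin R; ring.
    apply: le_trans (ler_normD _ _) _; rewrite normrZ normrN ger0_norm; last lra.
    have : (r - g) * `|y| <= r * L by rewrite ler_wpM2r//; lra.
    lra.
  have Mx : M * `|x - r *: y| <= M * (r * L + n) by rewrite ler_pM2l.
  have xrb : pairing (x - r *: y) b = - (r - g) * yb + pairing e b.
    by rewrite {1}xE !pairingE -/yb; ring.
  have yw_ge : - (M * L) <= yw by exact: dual_bound_ge.
  pose z := n * N / t.
  have z0 : 0 <= z by rewrite divr_ge0 ?(ltW t0)// mulr_ge0// ltW.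
  have zt : n * N = t * z by rewrite /z (mulrC t) divfK ?gt_eqF.
  have zg : n * N <= g * z by rewrite zt ler_wpM2r.
  have zd : 2 * (r * z) <= d * N.
    rewrite -(ler_pM2l t0); have := ler_wpM2r N_ge0 nr.
    have -> : n * (2 * r) * N = 2 * r * (n * N) by ring.
    rewrite zt; lra.
  have yb_ge : - yb <= M * L + z.
    rewrite -(ler_pM2l g0).
    have : 0 <= t * (k / 2) by rewrite !mulr_ge0 ?invr_ge0 ?ltW.
    have := ler_wpM2l (ltW g0) yw_ge; lra.
  have rg : 0 <= r - g by lra.
  rewrite -(ler_pM2r d0); have := ler_wpM2l rg yb_ge.
  have : g * (M * L) >= 0 by rewrite !mulr_ge0// ltW.
  have : M * n <= M by rewrite ler_piMr// ltW.
  have N0E : N0 * d = 2 * (2 * r * M * L + M * (1 + d)).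
    by rewrite /N0 divfK ?gt_eqF.
  lra.
have : r * (n * N) + n * M <= n * D.
  rewrite /D; have : r * (n * N) <= r * (n * N0) by rewrite !ler_pM2l.
  lra.
rewrite /q in nq q0; lra.
Qed.

Section Ray.
Variables (x0 : X) (a0 d M r : R).
Hypothesis Ex0 : E x0 a0.
Hypothesis d0 : 0 < d.
Hypothesis M0 : 0 < M.
Hypothesis r1 : 1 < r.
Hypothesis B1 : bounded_ball B x0 d M.
Hypothesis Br : bounded_ball B (r *: x0) d M.

Let L := `|x0|.
Let M1 := M * (r * L + 2 * d).

Let r0 : 0 < r. Proof. exact: lt_trans r1. Qed.

Let L_ge0 : 0 <= L. Proof. exact: normr_ge0. Qed.

Let M1_ge0 : 0 <= M1.
Proof.
rewrite mulr_ge0 ?(ltW M0)// addr_ge0//; last by rewrite mulr_ge0// ltW.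
by rewrite mulr_ge0 ?(ltW r0)// normr_ge0.
Qed.

(** Coercivity at the interior point [r x0]: as [r x0 - y] is close to
    [(r - s) x0] and [y] is close to [s x0], a large element of [B y] is very
    negative at [y]. *)
Lemma ray_coercive s0 s y ys : 0 < s0 -> s0 <= s <= 1 ->
  `|y - s *: x0| * (2 * r) <= s0 * d -> B y ys ->
  exists N, [/\ 0 <= N, dual_bound ys N &
    (r - s) * pairing y ys <= M1 - N * (s0 * d / 2)].
Proof.
move: (r1) (d0) (M0) => r1' d0' M0'.
move=> s00 /andP[s0s s1]; pose e := y - s *: x0; rewrite -/e => en By.
have [N [N0 Nys NE]] := bounded_ball_coercive mB d0 (ltW M0) Br By.
exists N; split=> //.
have yE : y = s *: x0 + e by rewrite /e; vlin R; ring.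
have e0 : 0 <= `|e| by [].
have ed : `|e| <= d.
  have h1 : `|e| * 1 <= `|e| * r by rewrite ler_wpM2l// ltW.
  have h2 : s0 * d <= 1 * d by rewrite ler_pM2r//; lra.
  lra.
have yr : `|y - r *: x0| <= r * L + d.
  have -> : y - r *: x0 = (s - r) *: x0 + e by rewrite {1}yE; vlin R; ring.
  apply: le_trans (ler_normD _ _) _; rewrite normrZ distrC ger0_norm; last lra.
  have : (r - s) * `|x0| <= r * L by rewrite ler_wpM2r//; lra.
  lra.
have My : M * `|y - r *: x0| <= M * (r * L + d) by rewrite ler_pM2l.
have xE : (r - s) * pairing x0 ys = M * (`|y - r *: x0| + d) - N * d + pairing e ys.
  by rewrite NE {2}yE !pairingE; ring.
have ey : pairing e ys <= N * `|e| by exact: Nys.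
have x_le : (r - s) * pairing x0 ys <= M1 - N * (d - `|e|).
  by rewrite xE /M1; lra.
have s_ge0 : 0 <= s by lra.
have h1 := ler_wpM2l s_ge0 x_le.
have rs : 0 <= r - s by lra.
have h2 := ler_wpM2l rs ey.
have M10 := M1_ge0.
have h3 : s * M1 <= M1 by rewrite ler_piMl.
have h4 : N * (`|e| * (2 * r)) <= N * (s0 * d) by rewrite ler_wpM2l.
have h5 : N * (s0 * d) <= N * (s * d) by rewrite ler_wpM2l// ler_pM2r.
rewrite {1}yE pairingDl pairingZl; lra.
Qed.

(** For [v = x + k (x0 - x)] with small [k], the radial
    estimate on a ray segment of length proportional to [k] around [v], together
    with the subgradient inequality at [x], bounds [<v, w>] from below for [w] in
    [B] near [v]; by coercivity these [w] are bounded as [k] tends to 0. *)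
Lemma subgrad_in_dom s0 s x xs : 0 < s0 -> s0 <= s <= 1 ->
  `|x - s *: x0| * (4 * r) <= s0 * d -> closed_dom B x -> subgrad E x xs ->
  B x !=set0.
Proof.
move: (r1) (d0) (M0) => r1' d0' M0'.
move=> s00 s01 xs4 cx [a [Ex xsub]].
have [P P0 Pxs] := dual_bounded xs.
pose A := `|x| + L + 1.
have A0 : 0 < A by rewrite ltr_wpDl// addr_ge0// L_ge0.
(* [1 + g k] and [1 - g k] are the ratios of the radial estimate at [v], small *)
(* enough to stay in the ball of radius [k d / 4] around [v] provided by *)
(* [closed_dom_ball]; [- Q] is the resulting lower bound of [<v, w>], *)
(* and [K] the bound on [w] that coercivity derives from it. *)
pose g := Num.min 2^-1 (d / (8 * A)).
have g0 : 0 < g by rewrite lt_min invr_gt0 ltr0n divr_gt0// mulr_gt0.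
have g2 : g <= 2^-1 by rewrite ge_min lexx.
have gA : g * (8 * A) <= d.
  by rewrite -ler_pdivlMr ?mulr_gt0// ge_min lexx orbT.
pose Q := (P * A + g * (P * A) + `|a0 - a|) / g.
have Q0 : 0 <= Q.
  have PA : 0 <= P * A by rewrite mulr_ge0// ltW.
  by rewrite divr_ge0 ?(ltW g0)// addr_ge0// addr_ge0// mulr_ge0// ltW.
have M10 := M1_ge0.
pose K := 2 * (M1 + 2 * r * Q) / (s0 * d) + 1.
have K0 : 0 < K.
  rewrite ltr_wpDl// divr_ge0 ?(ltW (mulr_gt0 s00 d0'))// mulr_ge0// addr_ge0//.
  by rewrite mulr_ge0// mulr_ge0// (ltW r0).
apply: (mem_dom_of_bounded mB K0) => e e0.
pose k := Num.min 1 (Num.min (s0 * d / (8 * r * A)) (e / (4 * A))).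
have k0 : 0 < k by rewrite !lt_min ltr01 !divr_gt0// !mulr_gt0.
have k1 : k <= 1 by rewrite ge_min lexx.
have kd : k * (8 * r * A) <= s0 * d.
  by rewrite -ler_pdivlMr ?mulr_gt0// !ge_min lexx !orbT.
have ke : k * (4 * A) <= e.
  by rewrite -ler_pdivlMr ?mulr_gt0// !ge_min lexx !orbT.
have [v vE] : exists v, v = (1 - k) *: x + k *: x0 by eexists.
have vA : `|v| <= A.
  rewrite vE; apply: le_trans (ler_normD _ _) _; rewrite !normrZ (gtr0_norm k0).
  rewrite ger0_norm ?subr_ge0//.
  have : (1 - k) * `|x| <= `|x| by rewrite ler_piMl// gerBl ltW.
  have : k * `|x0| <= L by rewrite ler_piMl.
  rewrite /A; lra.
have kg0 : 0 < k * g by rewrite mulr_gt0.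
have kg1 : k * g < 1.
  have : k * g <= 1 * g by rewrite ler_pM2r.
  lra.
have kgv : k * g * `|v| <= k * (d / 8).
  rewrite -mulrA ler_pM2l//; have : g * `|v| <= g * A by rewrite ler_pM2l.
  lra.
have ball_v q : `|q| <= k * g -> exists d' M', [/\ 0 < d', 0 < M' &
    bounded_ball B ((1 + q) *: v) d' M'].
  move=> qg; apply: (@locally_bounded _ _ _ mB _ (k * (d / 8))).
    by rewrite mulr_gt0// divr_gt0.
  move=> h hd; have -> : (1 + q) *: v + h = v + (q *: v + h) by vlin R; ring.
  rewrite {1}vE; apply: (closed_dom_ball mB d0 (ltW M0) B1 cx); first by rewrite k0.
  apply: le_trans (ler_normD _ _) _; rewrite normrZ.
  have : `|q| * `|v| <= k * g * `|v| by rewrite ler_wpM2r.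
  lra.
have kgE : `|k * g| <= k * g by rewrite gtr0_norm.
have [|d1 [N1 [d10 N10 b1]]] := ball_v 0; first by rewrite normr0 ltW.
have [|d2 [N2 [d20 N20 b2]]] := ball_v (- (k * g)); first by rewrite normrN.
have [d3 [N3 [d30 N30 b3]]] := ball_v _ kgE.
rewrite addr0 scale1r in b1.
pose d' := Num.min d1 (Num.min d2 d3); pose N' := Num.max N1 (Num.max N2 N3).
have d'0 : 0 < d' by rewrite !lt_min d10 d20.
have N'0 : 0 < N' by rewrite lt_max N10.
have [w Bw] : B ((1 + k * g) *: v) !=set0.
  by have := b3 0; rewrite normr0 addr0 => /(_ (ltW d30))[].
have Ev : E v ((1 - k) * a + k * a0).
  have -> : v = (1 - k) *: x + (1 - (1 - k)) *: x0 by rewrite vE; vlin R; ring.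
  have -> : (1 - k) * a + k * a0 = (1 - k) * a + (1 - (1 - k)) * a0 by ring.
  by apply: cE => //; rewrite subr_ge0 k1 gerBl ltW.
have Etv : E ((1 - k * g) *: v)
    ((1 - k) * a + k * a0 + (1 - (1 - k * g)) * pairing v w).
  apply: (@radial_estimate v _ _ (1 + k * g) w d' N') => //.
  - by rewrite subr_gt0 kg1 gtrBl.
  - by rewrite ltrDl.
  - apply: bounded_ballW b1; last by rewrite !le_max lexx.
    by rewrite !ge_min lexx.
  - apply: bounded_ballW b2; last by rewrite !le_max lexx !orbT.
    by rewrite !ge_min lexx !orbT.
  - apply: bounded_ballW b3; last by rewrite !le_max lexx !orbT.
    by rewrite !ge_min lexx !orbT.
have vw_ge : - Q <= pairing v w.
  have gQ : g * Q = P * A + g * (P * A) + `|a0 - a|.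
    by rewrite /Q mulrC divfK ?gt_eqF.
  rewrite -(ler_pM2l kg0).
  have vxs : pairing v xs = (1 - k) * pairing x xs + k * pairing x0 xs.
    by rewrite vE !pairingE.
  have h1 : k * (pairing x xs - pairing x0 xs) <= k * (P * A).
    rewrite ler_pM2l//; have := Pxs x; have := dual_bound_ge x0 Pxs.
    rewrite -/L /A; lra.
  have h2 : k * g * pairing v xs <= k * g * (P * A).
    by rewrite ler_pM2l//; apply: le_trans (Pxs v) _; rewrite ler_pM2l.
  have h3 : k * (a0 - a) <= k * `|a0 - a| by rewrite ler_pM2l// ler_norm.
  have h4 : k * (g * Q) = k * (P * A + g * (P * A) + `|a0 - a|) by rewrite gQ.
  have := xsub _ _ Etv; rewrite !(pairingDl, pairingZl, pairingNl).
  lra.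
pose y := (1 + k * g) *: v.
have yx : `|y - x| <= 2 * (k * A).
  have -> : y - x = k *: (x0 - x) + (k * g) *: v by rewrite /y vE; vlin R; ring.
  apply: le_trans (ler_normD _ _) _; rewrite !normrZ (gtr0_norm k0) (gtr0_norm g0).
  have : k * `|x0 - x| <= k * A.
    rewrite ler_pM2l//; apply: le_trans (ler_normB _ _) _; rewrite /A /L; lra.
  have : k * g * `|v| <= k * 1 * A.
    by rewrite ler_pM// ?(ltW kg0)// ler_pM2l//; lra.
  lra.
have [||N [N_ge0 Nw yw]] := @ray_coercive s0 s y w s00 s01 _ _.
- have h1 : `|y - s *: x0| <= 2 * (k * A) + `|x - s *: x0|.
    have -> : y - s *: x0 = (y - x) + (x - s *: x0) by vlin R; ring.
    by apply: le_trans (ler_normD _ _) _; rewrite lerD2r.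
  have : `|y - s *: x0| * (2 * r) <= (2 * (k * A) + `|x - s *: x0|) * (2 * r).
    by rewrite ler_pM2r// mulr_gt0.
  lra.
- exact: Bw.
exists y, w; split=> //.
  apply: le_lt_trans yx _; have : 0 < k * A by rewrite mulr_gt0.
  lra.
apply: dual_boundW Nw.
have /andP[s0s s1] := s01.
have h1 : - (2 * Q) <= pairing y w.
  have : (1 + k * g) * - Q <= (1 + k * g) * pairing v w.
    by rewrite ler_pM2l// addr_gt0.
  have : k * g * Q <= 1 * Q by rewrite ler_wpM2r// ltW.
  rewrite /y pairingZl; lra.
have h2 : - (2 * r * Q) <= (r - s) * pairing y w.
  have rs : 0 <= r - s by lra.
  have := ler_wpM2l rs h1; have : 0 <= s * Q by rewrite mulr_ge0//; lra.
  lra.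
have sd0 : 0 < s0 * d by rewrite mulr_gt0.
have KE : (K - 1) * (s0 * d) = 2 * (M1 + 2 * r * Q).
  by rewrite /K addrK divfK ?gt_eqF.
suff : N * (s0 * d) <= (K - 1) * (s0 * d) by rewrite ler_pM2r//; lra.
lra.
Qed.

(** If 0 were outside the closure [C] of the domain, the sum of the function and
    the indicator of [C] would be infinite at 0, so it would have subgradients
    [xs] with [<x, xs>] arbitrarily negative near the segment. Such an [xs] splits
    into a subgradient of the function and a normal vector to [C]; the latter is
    absorbed by [B x], which is nonempty by [subgrad_in_dom], and coercivity
    bounds [B x] at [x] from above. *)
Lemma zero_closed_dom : closed_dom B 0.
Proof.
move: (r1) (d0) (M0) (r0) (M1_ge0) (L_ge0) => r1' d0' M0' r0' M10 L0.
apply: contrapT => nC.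
have [z z0 zP] : exists2 z, 0 < z & forall y, closed_dom B y -> z <= `|y|.
  apply: contra_notP nC => h e e0; apply: contrapT => nB; apply: h; exists e => //.
  move=> y cy; rewrite leNgt; apply/negP => ye.
  have [y' y'y By'] := cy (e - `|y|) (eqbRL (subr_gt0 _ _) ye).
  apply: nB; exists y' => //; rewrite subr0.
  have := ler_normD (y' - y) y; rewrite subrK; lra.
pose E' := restrict_rel E (closed_dom B).
have convC := closed_dom_convex mB d0 (ltW M0) B1.
have cE' : convex_rel E'.
  by move=> x a y b t t01 [Ex cx] [Ey cy]; split; [exact: cE|exact: convC].
have upE' : upward_rel E' by move=> x a b [Ex cx] ab; split=> //; exact: upE ab.
have clE' : closed_rel E'.
  move=> x a h; split.
    by apply: clE => e e0; have [y [xy [Ey _]]] := h e e0; exists y.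
  move=> e e0; have e2 : 0 < e / 2 by rewrite divr_gt0.
  have [y [xy [_ /(_ _ e2)[y' y'y By']]]] := h _ e2; exists y' => //.
  have := ler_distD y y' x; lra.
have minE' x a : E' x a -> pairing x p + c0 <= a by move=> [Ex _]; exact: minE.
have C0 h : `|h| < d -> closed_dom B (x0 + h).
  by move=> hd; apply: mem_closed_dom; have [] := B1 (ltW hd).
have Ex0' : E' x0 a0.
  by split=> //; have := C0 0; rewrite normr0 addr0; apply.
pose s0 := z / (2 * (L + 1)).
have L1 : 0 < L + 1 by lra.
have s00 : 0 < s0 by rewrite divr_gt0// mulr_gt0.
have s0L : s0 * (2 * (L + 1)) = z by rewrite /s0 divfK// gt_eqF// mulr_gt0.
pose n := Num.min (z / 2) (s0 * d / (4 * r)).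
have n0 : 0 < n by rewrite lt_min !divr_gt0// mulr_gt0.
have nz : n <= z / 2 by rewrite ge_min lexx.
have nd : n * (4 * r) <= s0 * d.
  by rewrite -ler_pdivlMr ?mulr_gt0// ge_min lexx orbT.
have r10 : 0 < r - 1 by rewrite subr_gt0.
(* The slope [T] beats the upper bound [M1 / (r - 1)] of [<x, ys>] for every *)
(* ratio [q >= s0], and [s0] is positive because [C] stays away from 0. *)
pose T := (M1 / (r - 1) + 1) / s0.
have T0 : 0 < T.
  by rewrite divr_gt0// ltr_wpDl// divr_ge0// (ltW r10).
have nE0 : ~ E' 0 (a0 + n + T) by move=> [_ /nC].
have [s [x [xs [/andP[s_ge0 s_lt1] xn [a xsub] dx slope]]]] :=
  approx_mean_value cE' upE' clE' minE' Ex0' nE0 n0.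
pose q := 1 - s; have qx : x0 + s *: (0 - x0) = q *: x0.
  by rewrite /q; vlin R; ring.
rewrite qx in xn dx; rewrite sub0r pairingNl in slope.
have [[Ex Cx] _] := xsub.
have q1 : q <= 1 by rewrite /q gerBl.
have q0 : 0 < q by rewrite /q subr_gt0.
have s0q : s0 <= q.
  have zx := zP _ Cx.
  have : `|x| <= q * L + n.
    have -> : x = q *: x0 + (x - q *: x0) by vlin R; ring.
    by apply: le_trans (ler_normD _ _) _; rewrite normrZ gtr0_norm// lerD2l.
  move=> xq; rewrite -(ler_pM2r L1).
  lra.
have [ns [b nsub] nsC] := subgrad_restrict cE convC Ex0 d0 C0 xsub.
have x4 : `|x - q *: x0| * (4 * r) <= s0 * d.
  by apply: le_trans nd; rewrite ler_pM2r// mulr_gt0.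
have s0q1 : s0 <= q <= 1 by rewrite s0q.
have x2 : `|x - q *: x0| * (2 * r) <= s0 * d.
  apply: le_trans x4; rewrite ler_wpM2l//; lra.
have [ys By] := subgrad_in_dom s00 s0q1 x4 Cx (ex_intro _ b nsub).
have [N [N_ge0 _ xys]] := ray_coercive s00 s0q1 x2 By.
have Bns : B x (ys + ns).
  apply: mB.2 => y zs Bz; have := mB.1 _ _ _ _ By Bz.
  have := nsC _ (mem_closed_dom (ex_intro _ zs Bz)); rewrite !pairingE; lra.
have := related0 (ex_intro _ b nsub) Bns.
have -> : xs - ns + (ys + ns) = xs + ys by vlin R; ring.
rewrite pairingDr => rel.
have xs_le : pairing x xs <= - (M1 / (r - 1) + 1).
  have h1 : pairing x xs <= q * pairing x0 xs.
    by move: dx; rewrite pairingDl pairingZl pairingNl; lra.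
  have h2 : q * pairing x0 xs <= q * - T by rewrite ler_pM2l//; lra.
  have h3 : s0 * T <= q * T by rewrite ler_pM2r.
  have h4 : s0 * T = M1 / (r - 1) + 1 by rewrite /T mulrC divfK ?gt_eqF.
  lra.
have ys_le : pairing x ys <= M1 / (r - 1).
  rewrite ler_pdivlMr// mulrC.
  have [neg|pos] := leP (pairing x ys) 0.
    by apply: le_trans M10; rewrite mulr_ge0_le0// ltW.
  apply: le_trans (_ : (r - q) * pairing x ys <= _).
    by rewrite ler_pM2r//; lra.
  by apply: le_trans xys _; rewrite gerBl mulr_ge0// divr_ge0// ltW// mulr_gt0.
lra.
Qed.

End Ray.
(** The limit [t -> 0] of the radial estimate. Since [0 * y] need not be interior
    to the domain, this uses the closedness of the epigraph; that the value at 0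
    is finite is part of the conclusion. *)
Lemma radial_estimate0 y a r w d1 M1 d3 M3 : closed_dom B 0 -> 1 < r ->
  E y a -> 0 < d1 -> 0 < M1 -> bounded_ball B y d1 M1 ->
  0 < d3 -> bounded_ball B (r *: y) d3 M3 -> B (r *: y) w ->
  E 0 (a + pairing y w).
Proof.
move=> C0 r1 Ey d10 M10 b1 d30 b3 Bw; apply: clE => e e0.
pose A := `|y| + `|pairing y w| + 1.
have A0 : 0 < A by rewrite ltr_wpDl// addr_ge0.
pose t := Num.min (1 / 2) (e / (2 * A)).
have t0 : 0 < t by rewrite lt_min !divr_gt0// mulr_gt0.
have t2 : t <= 1 / 2 by rewrite ge_min lexx.
have tA : t * (2 * A) <= e.
  by rewrite -ler_pdivlMr ?mulr_gt0// ge_min lexx orbT.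
have t01 : 0 < t <= 1 by rewrite t0; lra.
have [d2 [M2 [d20 M20]]] := closed_dom_bounded mB d10 (ltW M10) b1 C0 t01.
rewrite scaler0 add0r => b2.
have [d [M [d0 M0 {}b1 {}b2 {}b3]]] := bounded_ball_common3 d10 M10 d20 d30 b1 b2 b3.
have t1 : 0 < t < 1 by rewrite t0; lra.
have Ety := radial_estimate t1 r1 d0 M0 Ey b1 b2 b3 Bw.
have ty0 : 0 <= t * `|y| by rewrite mulr_ge0// ltW.
have tw0 : 0 <= t * `|pairing y w| by rewrite mulr_ge0// ltW.
exists (t *: y); split.
  by rewrite subr0 normrZ gtr0_norm//; rewrite /A in tA; lra.
apply: upE Ety _.
have : t * - pairing y w <= t * `|pairing y w|.
  by rewrite ler_pM2l// -normrN ler_norm.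
rewrite /A in tA; lra.
Qed.

Lemma least_value x a : E x a -> exists2 b, E x b & forall c, E x c -> b <= c.
Proof.
move=> Ex; have l : has_lbound [set c | E x c].
  by exists (pairing x p + c0) => c; exact: minE.
have n : [set c | E x c] !=set0 by exists a.
exists (inf [set c | E x c]); last by move=> c Ec; exact: ge_inf.
apply: clE => e e0; exists x; rewrite subrr normr0 e0; split=> //.
have [c Ec ce] := inf_adherent e0 (conj n l).
by apply: upE Ec _; exact: ltW.
Qed.

Variables (x0 : X) (a0 d M : R).
Hypothesis Ex0 : E x0 a0.
Hypothesis d0 : 0 < d.
Hypothesis M0 : 0 < M.
Hypothesis Bx0 : bounded_ball B x0 d M.

Lemma interior_ray : exists r, [/\ 1 < r, bounded_ball B x0 (d / 2) M &
  bounded_ball B (r *: x0) (d / 2) M].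
Proof.
move: (d0) => d0'.
pose L := `|x0| + 1; have L0 : 0 < L by rewrite ltr_wpDl.
pose q := d / (2 * L); have q0 : 0 < q by rewrite divr_gt0// mulr_gt0.
have qL : q * (2 * L) = d by rewrite /q divfK// gt_eqF// mulr_gt0.
exists (1 + q); split.
- by rewrite ltrDl.
- by apply: bounded_ballW Bx0 => //; lra.
- move=> h hd; have -> : (1 + q) *: x0 + h = x0 + (q *: x0 + h) by vlin R; ring.
  apply: Bx0; apply: le_trans (ler_normD _ _) _; rewrite normrZ gtr0_norm//.
  have : q * `|x0| <= q * L by rewrite ler_pM2l// lerDl.
  lra.
Qed.

Lemma graph_hull_closed_dom y ys b : graph_hull B y ys b -> closed_dom B y.
Proof.
move=> hy e e0; pose A := `|x0 - y| + 1.
have A0 : 0 < A by rewrite ltr_wpDl.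
pose t := Num.min 1 (e / A).
have t0 : 0 < t by rewrite lt_min ltr01 divr_gt0.
have t01 : 0 < t <= 1 by rewrite t0 ge_min lexx.
exists ((1 - t) *: y + t *: x0); last exact: (segment_in_dom mB d0 (ltW M0) Bx0 hy t01).
have -> : (1 - t) *: y + t *: x0 - y = t *: (x0 - y) by vlin R; ring.
rewrite normrZ gtr0_norm//.
have : t * A <= e by rewrite -ler_pdivlMr// ge_min lexx orbT.
rewrite /A; lra.
Qed.

(** The sandwich inequality between minus the function and the hull of the graph.
    At an interior point [y] of the domain take [w] in [B (t y)]: the radial
    estimate and convexity give [f 0 - f y <= <y, w>], and monotonicity gives
    [<y, w> + t <y, ys> - t <y, w> <= b]; let [t] tend to 0. Other points are
    limits along the segment to [x0]. *)
Lemma least_value_le f0 y ys b a : closed_dom B 0 -> E 0 f0 ->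
  (forall c, E 0 c -> f0 <= c) -> graph_hull B y ys b -> E y a -> f0 <= a + b.
Proof.
move=> C0 E0 f0min.
have inner z zs e c : graph_hull B z zs e -> E z c ->
    (exists d' M', [/\ 0 < d', 0 < M' & bounded_ball B z d' M']) -> f0 <= c + e.
  move=> hz Ez [d' [M' [d'0 M'0 bz]]].
  apply/ler_addgt0Pr => k k0.
  pose D := `|f0 - c - pairing z zs| + 1.
  have D0 : 0 < D by rewrite ltr_wpDl.
  pose t := Num.min 1 (k / D).
  have t0 : 0 < t by rewrite lt_min ltr01 divr_gt0.
  have t1 : t <= 1 by rewrite ge_min lexx.
  have tD : t * D <= k by rewrite -ler_pdivlMr// ge_min lexx orbT.
  have t01 : 0 < t <= 1 by rewrite t0.
  have th0 : 0 < t / 2 by rewrite divr_gt0.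
  have th1 : 0 < t / 2 <= 1 by rewrite th0; lra.
  have [d1 [M1 [d10 M10]]] := closed_dom_bounded mB d'0 (ltW M'0) bz C0 th1.
  have [d2 [M2 [d20 M20]]] := closed_dom_bounded mB d'0 (ltW M'0) bz C0 t01.
  rewrite !scaler0 !add0r => b2 b1.
  have [w Bw] : B (t *: z) !=set0.
    by have := b2 0; rewrite normr0 addr0 => /(_ (ltW d20))[].
  have tzE : t *: z = 2 *: ((t / 2) *: z) by vlin R; field.
  have Bw2 := Bw; rewrite tzE in b2 Bw2.
  have Ez2 : E ((t / 2) *: z) (t / 2 * c + (1 - t / 2) * f0).
    have -> : (t / 2) *: z = (t / 2) *: z + (1 - t / 2) *: 0.
      by rewrite scaler0 addr0.
    by apply: cE => //; move: th1; lra.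
  have := f0min _ (radial_estimate0 C0 (ltr1n _ 2) Ez2 d10 M10 b1 d20 b2 Bw2).
  rewrite pairingZl => h1.
  have h2 : f0 - c <= pairing z w.
    by rewrite -(ler_pM2l th0); lra.
  have := graph_hull_ge mB hz Bw; rewrite !pairingZl => h3.
  have h4 : (1 - t) * (f0 - c) <= (1 - t) * pairing z w.
    by rewrite ler_wpM2l// subr_ge0.
  have : t * (f0 - c - pairing z zs) <= t * `|f0 - c - pairing z zs|.
    by rewrite ler_pM2l// ler_norm.
  rewrite /D in tD; lra.
move=> hy Ey; apply/ler_addgt0Pr => k k0.
have [us Bus] : B x0 !=set0.
  by have := Bx0; move=> /(_ 0); rewrite normr0 addr0 => /(_ (ltW d0))[].
pose V := a0 + pairing x0 us - (a + b).
pose s := Num.min 1 (k / (`|V| + 1)).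
have V0 : 0 < `|V| + 1 by rewrite ltr_wpDl.
have s0 : 0 < s by rewrite lt_min ltr01 divr_gt0.
have s1 : s <= 1 by rewrite ge_min lexx.
have sV : s * (`|V| + 1) <= k by rewrite -ler_pdivlMr// ge_min lexx orbT.
have s01 : 0 < s <= 1 by rewrite s0.
have s01' : 0 <= 1 - s <= 1 by rewrite subr_ge0 s1 gerBl ltW.
have := closed_dom_bounded mB d0 (ltW M0) Bx0 (graph_hull_closed_dom hy) s01.
have -> : (1 - s) *: y + s *: x0 = (1 - s) *: y + (1 - (1 - s)) *: x0.
  by vlin R; ring.
move=> /(inner _ _ _ _ (graph_hull_conv s01' hy (graph_hull_base Bus))
  (cE s01' Ey Ex0)).
have : s * V <= s * `|V| by rewrite ler_pM2l// ler_norm.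
rewrite /V in sV *; lra.
Qed.

(** A functional separating minus the function from the hull of the graph, both
    normalised at 0, is an element of [B 0] whose opposite is a subgradient. *)
Lemma mem_sum0 : exists2 xs, subgrad E 0 (- xs) & B 0 xs.
Proof.
move: (d0) (M0) => d0' M0'.
have [r [r1 B1 Br]] := interior_ray.
have d2 : 0 < d / 2 by rewrite divr_gt0.
have C0 := zero_closed_dom Ex0 d2 M0 r1 B1 Br.
have [w Bw] : B (r *: x0) !=set0.
  by have := Br 0; rewrite normr0 addr0 => /(_ (ltW d2))[].
have E0 := radial_estimate0 C0 r1 Ex0 d2 M0 B1 d2 Br Bw.
have [f0 Ef0 f0min] := least_value E0.
pose F y a := E y (a + f0).
have [||||||l hl] := @sandwich R X F (hull_gap B 0) x0 (a0 - f0)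
    (M * (`|x0| + d)) d.
- move=> x a y b t t01 Fx Fy; have := cE t01 Fx Fy; rewrite /F.
  by congr (E _ _); ring.
- exact: hull_gap_convex.
- move=> y a b Fy [ys [c [hy cb]]]; rewrite pairing0l subr0 in cb.
  have := least_value_le C0 Ef0 f0min hy Fy; lra.
- by rewrite /F subrK.
- exact: d0.
- move=> h hd; have [[us Bus] /(_ _ Bus) ub] := Bx0 (ltW hd).
  exists us, (pairing (x0 + h) us); split; first exact: graph_hull_base.
  rewrite pairing0l subr0; apply: le_trans (ub _) _; rewrite ler_pM2l//.
  by apply: le_trans (ler_normD _ _) _; rewrite lerD2l ltW.
have Bl : B 0 l.
  apply: (mem_of_hull_gap mB) => y c hy.
  by have := hl 0 0 y c; rewrite /F add0r => /(_ Ef0 hy); rewrite add0r.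
exists l => //; exists f0; split=> // y b Ey.
have Fy : F y (b - f0) by rewrite /F subrK.
have := hl _ _ _ _ Fy (hull_gap_base 0 Bl).
rewrite subrr pairing0l !pairingE; lra.
Qed.

End MonotonicallyRelated.

(** * Epigraphs, translations and the sum theorem *)

Section Epigraph.
Context {R : realType} {X : completeNormedModType R}.

Definition epigraph (f : X -> \bar R) (x : X) (a : R) : Prop := (f x <= a%:E)%E.

Lemma epigraph_upward f : upward_rel (epigraph f).
Proof. by move=> x a b; rewrite /epigraph -lee_fin; exact: le_trans. Qed.

Lemma epigraph_convex f : convex_efun f -> convex_rel (epigraph f).
Proof.
move=> cf x a y b t t01 fx fy; apply: le_trans (cf x y t t01) _.
have /andP[t0 t1] := t01; rewrite (EFinD (t * a)) !EFinM.
by apply: leeD; apply: lee_wpmul2l => //; rewrite lee_fin ?subr_ge0.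
Qed.

Lemma epigraph_closed f : lower_semicontinuous f -> closed_rel (epigraph f).
Proof.
move=> lf x a h; rewrite /epigraph leNgt; apply/negP => lt.
have [b ab bf] : exists2 b, a < b & (b%:E < f x)%E.
  case: (f x) lt => [r|_|] //.
  - by rewrite lte_fin => ar; exists ((a + r) / 2); rewrite ?lte_fin; lra.
  - by exists (a + 1); [rewrite ltrDl|exact: ltry].
have [V /nbhs_ballP[d /= d0 dV] Vb] := lf _ _ bf.
have [|y [yx Ey]] := h (Num.min d (b - a)); first by rewrite lt_min d0 subr_gt0.
have : (b%:E < f y)%E.
  apply/Vb/dV; rewrite -ball_normE /ball_/= distrC.
  by apply: lt_le_trans yx _; rewrite ge_min lexx.
rewrite ltNge => /negP; apply; apply: le_trans Ey _.
by rewrite lee_fin -lerBrDl ge_min lexx orbT.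
Qed.

Lemma subgrad_epigraph f x xs : (forall x, f x != -oo%E) -> proper_fun f ->
  subdifferential f x xs <-> subgrad (epigraph f) x xs.
Proof.
move=> fN [y0 fy0]; split=> [sf|[a [Ea asub]] y].
  have fx : f x \is a fin_num.
    rewrite fin_numE fN /=; apply/eqP => fx.
    by have := sf y0; rewrite fx addey// leye_eq; move: fy0; case: (f y0).
  exists (fine (f x)); split; first by rewrite /epigraph fineK.
  move=> y b; rewrite /epigraph => fyb; have := le_trans (sf y) fyb.
  by rewrite -(fineK fx) -EFinD lee_fin.
case fy : (f y) => [b||]; last by have := fN y; rewrite fy.
  have := asub y b; rewrite /epigraph fy lexx => /(_ isT); rewrite -lee_fin EFinD.
  by apply: le_trans; exact: leeD2l.
by rewrite leey.
Qed.

Lemma subgrad_translate (E : X -> R -> Prop) z x xs :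
  subgrad (fun y => E (y + z)) x xs <-> subgrad E (x + z) xs.
Proof.
split=> -[a [Ea asub]]; exists a; split=> // y b Ey.
  have := asub (y - z) b; rewrite subrK => /(_ Ey).
  by congr (pairing _ _ + _ <= _); vlin R; ring.
have := asub _ _ Ey.
by congr (pairing _ _ + _ <= _); vlin R; ring.
Qed.

End Epigraph.

Section Maximality.
Context {R : realType} {X : completeNormedModType R}.
Implicit Types (A B : X -> set (dual X)).

Lemma maximally_monotoneP B : maximally_monotone B <-> max_mono B.
Proof.
split=> [[mono maxi]|[mono maxi]].
  have mono' x xs y ys : B x xs -> B y ys -> 0 <= pairing (x - y) (xs - ys).
    by move=> Bx By; exact: (mono (x, xs) (y, ys)).
  split=> // x xs rel; apply: contrapT => nB; apply: maxi.
  exists (fun y => [set ys | B y ys \/ (y, ys) = (x, xs)]); split.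
    move=> [y ys] [u us]; rewrite /gra/= => -[By|[-> ->]] [Bu|[-> ->]].
    - exact: mono'.
    - have h : 0 <= pairing (y - x) (ys - xs).
        by have := rel _ _ By; rewrite !pairingE; lra.
      exact: h.
    - exact: rel.
    - have h : 0 <= pairing (x - x) (xs - xs) by rewrite subrr pairing0l.
      exact: h.
  split=> [q Bq|sub]; first by left.
  by apply: nB; apply: (sub (x, xs)); right.
split=> [q q'|[D [monoD [BD]]]]; first exact: mono.
apply=> -[x xs] Dx; apply: maxi => y ys By.
exact: (monoD (x, xs) (y, ys) Dx (BD (y, ys) By)).
Qed.

Lemma max_mono_translate B z zs : max_mono B ->
  max_mono (fun x => [set xs | B (x + z) (xs + zs)]).
Proof.
move=> [mono maxi]; split=> [x xs y ys Bx By|x xs rel].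
  by have := mono _ _ _ _ Bx By; rewrite !pairingE; lra.
apply: maxi => y ys By.
have By' : B (y - z + z) (ys - zs + zs) by rewrite !subrK.
have := rel _ _ By'; rewrite !pairingE; lra.
Qed.

End Maximality.

Theorem corollary3p4 (R : realType) (X : completeNormedModType R)
    (f : X -> \bar R) (B : X -> set (dual X)) :
  (forall x, f x != -oo%E) ->
  proper_fun f ->
  lower_semicontinuous f ->
  convex_efun f ->
  maximally_monotone B ->
  dom (subdifferential f) `&` interior (dom B) !=set0 ->
  maximally_monotone (op_sum (subdifferential f) B).
Proof.
move=> fN pf lf cf /maximally_monotoneP mB [x0 [[p fp] intB]].
have subE x xs := subgrad_epigraph x xs fN pf.
have upE := @epigraph_upward R X f.
have cE := epigraph_convex cf; have clE := epigraph_closed lf.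
have /subE[a0 [Ex0 minx0]] := fp.
apply/maximally_monotoneP; split.
  move=> x _ y _ [xs /subE[a [Ea suba]] [xt Bx <-]] [ys /subE[b [Eb subb]] [yt By <-]].
  have := mB.1 _ _ _ _ Bx By; have := suba _ _ Eb; have := subb _ _ Ea.
  rewrite !pairingE; lra.
move=> z zs rel.
pose E' x a := epigraph f (x + z) a.
pose B' x : set (dual X) := [set xs | B (x + z) (xs + zs)].
have mB' : max_mono B' by exact: max_mono_translate.
have cE' : convex_rel E'.
  move=> x a y b t t01 Ex Ey; have := cE _ _ _ _ _ t01 Ex Ey.
  by congr (epigraph f _ _); vlin R; ring.
have upE' : upward_rel E' by move=> x a b; exact: upE.
have clE' : closed_rel E'.
  move=> x a h; apply: clE => e /h[y [yx Ey]]; exists (y + z); split=> //.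
  by have -> : y + z - (x + z) = y - x by vlin R; ring.
have minE' x a : E' x a -> pairing x p + (pairing (z - x0) p + a0) <= a.
  by move=> /minx0; rewrite !pairingE; lra.
have related x xs ys : subgrad E' x xs -> B' x ys -> 0 <= pairing x (xs + ys).
  move=> /subgrad_translate/subE sx Bx.
  have sBx : op_sum (subdifferential f) B (x + z) (xs + (ys + zs)).
    by exists xs => //; exists (ys + zs).
  have := rel _ _ sBx; rewrite !pairingE; lra.
have [d /= d0 dB] : exists2 d : R, 0 < d & ball x0 d `<=` dom B.
  by move: intB => /nbhs_ballP[d /= d0 dB]; exists d.
have Bball h : `|h| < d -> B' (x0 - z + h) !=set0.
  move=> hd; have [|us Bus] := dB (x0 + h).
    by rewrite -ball_normE /ball_/= opprD addrA subrr sub0r normrN.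
  exists (us - zs); rewrite /B'/= subrK.
  by have -> : x0 - z + h + z = x0 + h by vlin R; ring.
have [d' [M [d'0 M0 bB]]] := locally_bounded mB' d0 Bball.
have Ex0' : E' (x0 - z) a0 by rewrite /E' subrK.
have [xs /subgrad_translate/subE] :=
  mem_sum0 cE' upE' clE' minE' mB' related Ex0' d'0 M0 bB.
rewrite /B'/= add0r => sz Bz.
exists (- xs) => //; exists (xs + zs) => //.
by rewrite addrA addNr add0r.
Qed.
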